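(* There is a sequence of finitely generated subgroups $B<K<F$ of Thompson's group $F$ such that $B$ is elementary amenable and maximal in $K$, $K$ is normal in $F$ and $F/K$ is infinite cyclic.
   Context: Thompson's group $F$ is the group of all piecewise-linear increasing homeomorphisms of $[0,1]$ with finitely many breakpoints, all in $\mathbb{Z}[\frac12]\cap(0,1)$, and all slopes integer powers of $2$. The class of elementary amenable groups is the smallest class of groups containing all finite and all abelian groups and closed under subgroups, quotients, extensions and directed unions. *)

(* Defs.v *)
From HB Require Import structures.
From mathcomp Require Import all_boot all_order all_algebra.
From mathcomp Require Import mathcomp_extra boolp classical_sets functions.
From mathcomp Require Import cardinality reals topology normedtype.
From mathcomp Require Import ring.

Set Implicit Arguments.
Unset Strict Implicit.
Unset Printing Implicit Defensive.

Import Order.TTheory GRing.Theory Num.Theory.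
Import numFieldNormedType.Exports.

Local Open Scope classical_set_scope.
Local Open Scope quotient_scope.

Definition is_subgroup (G : groupType) (H : set G) : Prop :=
  [/\ H 1%g, forall x y, H x -> H y -> H (x * y)%g
    & forall x, H x -> H x^-1%g].

Record subgroup (G : groupType) := Subgroup {
  subgroup_set :> set G;
  subgroupP : is_subgroup subgroup_set }.

Section SubgroupType.
Variables (G : groupType) (H : subgroup G).

Definition subgroup_type := {x : G | x \in (H : set G)}.

HB.instance Definition _ := SubChoice.on subgroup_type.

Fact subgroup_closed : group_closed (mem (H : set G)).
Proof.
have [H1 HM HV] := subgroupP H.
split=> [|x y]; rewrite ?inE // => Hx Hy.
by apply: HM => //; exact: HV.
Qed.

HB.instance Definition _ :=
  SubChoice_isSubGroup.Build G _ subgroup_type subgroup_closed.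

End SubgroupType.

Coercion subgroup_group (G : groupType) (H : subgroup G) : groupType :=
  subgroup_type H.

Definition normal (G : groupType) (N : subgroup G) : Prop :=
  forall g x : G, (N : set G) x -> (N : set G) (x ^ g)%g.

Section Quotient.
Variables (G : groupType) (N : subgroup G).

Definition coset_rel : rel G := fun x y => (x^-1 * y)%g \in (N : set G).

Fact coset_rel_refl : reflexive coset_rel.
Proof. by have [N1 _ _] := subgroupP N; move=> x; rewrite /coset_rel mulVg inE. Qed.

Fact coset_rel_sym : symmetric coset_rel.
Proof.
have [_ _ NV] := subgroupP N.
by move=> x y; apply/idP/idP; rewrite /coset_rel !inE => /NV; rewrite invgM invgK.
Qed.

Fact coset_rel_trans : transitive coset_rel.
Proof.
have [_ NM _] := subgroupP N.
move=> y x z; rewrite /coset_rel !inE => xy yz.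
by have := NM _ _ xy yz; rewrite mulgA -(mulgA _ y) mulgV mulg1.
Qed.

Canonical coset_equiv :=
  EquivRel coset_rel coset_rel_refl coset_rel_sym coset_rel_trans.

Definition quotient (_ : normal N) := {eq_quot coset_rel}.

Variable nN : normal N.
Local Notation Q := (quotient nN).

HB.instance Definition _ := Choice.on Q.
HB.instance Definition _ := EqQuotient.on Q.

Definition quotient_one : Q := \pi_Q 1%g.
Definition quotient_mul (u v : Q) : Q := \pi_Q (repr u * repr v)%g.
Definition quotient_inv (u : Q) : Q := \pi_Q (repr u)^-1%g.

Fact quotient_eqP (x y : G) :
  \pi_Q x = \pi_Q y <-> (N : set G) (x^-1 * y)%g.
Proof.
split=> [/eqmodP|Nxy]; first by rewrite /= /coset_rel inE.
by apply/eqmodP; rewrite /= /coset_rel inE.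
Qed.

Fact quotient_mulE (x y : G) :
  \pi_Q (x * y)%g = quotient_mul (\pi_Q x) (\pi_Q y).
Proof.
have [_ NM _] := subgroupP N.
rewrite /quotient_mul; case: piP => x' /quotient_eqP xx'.
case: piP => y' /quotient_eqP yy'; apply/quotient_eqP.
have := NM _ _ (nN y xx') yy'.
by rewrite /conjg invgM -!mulgA mulVKg.
Qed.

Fact quotient_invE (x : G) : \pi_Q (x^-1)%g = quotient_inv (\pi_Q x).
Proof.
have [_ _ NV] := subgroupP N.
rewrite /quotient_inv; case: piP => x' /quotient_eqP xx'; apply/quotient_eqP.
have := nN x^-1%g (NV _ xx').
by rewrite /conjg !invgM !invgK -!mulgA mulgV mulg1.
Qed.

Fact quotient_mulA : associative quotient_mul.
Proof.
move=> u v w; rewrite -[u]reprK -[v]reprK -[w]reprK.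
rewrite -(quotient_mulE (repr v)) -(quotient_mulE (repr u) (repr v)).
by rewrite -2!quotient_mulE mulgA.
Qed.

Fact quotient_mul1g : left_id quotient_one quotient_mul.
Proof. by move=> u; rewrite -[u]reprK -quotient_mulE mul1g. Qed.

Fact quotient_mulg1 : right_id quotient_one quotient_mul.
Proof. by move=> u; rewrite -[u]reprK -quotient_mulE mulg1. Qed.

Fact quotient_mulVg : left_inverse quotient_one quotient_inv quotient_mul.
Proof.
by move=> u; rewrite -[u]reprK -quotient_invE -quotient_mulE mulVg.
Qed.

Fact quotient_mulgV : right_inverse quotient_one quotient_inv quotient_mul.
Proof.
by move=> u; rewrite -[u]reprK -quotient_invE -quotient_mulE mulgV.
Qed.

HB.instance Definition _ := isGroup.Build Q quotient_mulA
  quotient_mul1g quotient_mulg1 quotient_mulVg quotient_mulgV.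

End Quotient.

Definition generated (G : groupType) (S : set G) : set G :=
  smallest (@is_subgroup G) S.

Definition finitely_generated (G : groupType) : Prop :=
  exists2 S : set G, finite_set S & generated S = setT.

Definition infinite_cyclic (G : groupType) : Prop :=
  (exists t : G, generated [set t] = setT) /\ infinite_set [set: G].

Definition maximal_in (G : groupType) (B K : subgroup G) : Prop :=
  B `<` K /\
  forall M : subgroup G, B `<=` M -> M `<=` K ->
    M = B :> set G \/ M = K :> set G.

(* [ea_isog] is needed because a class of groups is closed under isomorphism,
   whereas [subgroup G] and [quotient nN] only produce particular carriers. *)
Inductive elementary_amenable : groupType -> Prop :=
| ea_finite (G : groupType) :
    finite_set [set: G] -> elementary_amenable G
| ea_abelian (G : groupType) :
    (forall x y : G, commute x y) -> elementary_amenable G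
| ea_isog (G H : groupType) (f : {multiplicative G -> H}) :
    bijective f -> elementary_amenable G -> elementary_amenable H
| ea_subgroup (G : groupType) (H : subgroup G) :
    elementary_amenable G -> elementary_amenable H
| ea_quotient (G : groupType) (N : subgroup G) (nN : normal N) :
    elementary_amenable G -> elementary_amenable (quotient nN)
| ea_extension (G : groupType) (N : subgroup G) (nN : normal N) :
    elementary_amenable N -> elementary_amenable (quotient nN) ->
    elementary_amenable G
| ea_directed_union (G : groupType) (D : set (subgroup G)) :
    D !=set0 ->
    (forall H1 H2, D H1 -> D H2 ->
       exists H3, [/\ D H3, H1 `<=` H3 & H2 `<=` H3]) ->
    \bigcup_(H in D) H = setT ->
    (forall H, D H -> elementary_amenable H) ->
    elementary_amenable G.

Definition is_homeo (T : topologicalType) (f : T -> T) : Prop :=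
  continuous f /\
  exists g : T -> T, [/\ continuous g, cancel f g & cancel g f].

Record homeo (T : topologicalType) := Homeo {
  homeo_fun :> T -> T;
  homeoP : is_homeo homeo_fun }.

Section HomeoGroup.
Variable T : topologicalType.
Implicit Types f g h : homeo T.

HB.instance Definition _ := gen_eqMixin (homeo T).
HB.instance Definition _ := gen_choiceMixin (homeo T).

Fact homeo_ext f g : f =1 g -> f = g.
Proof.
case: f g => f fP [g gP] /= /funext fg.
by move: gP; rewrite -fg => gP; rewrite (Prop_irrelevance fP gP).
Qed.

Fact is_homeo_id : is_homeo (@id T).
Proof. by split; [move=> ?|exists id; split=> // ?]. Qed.

Fact is_homeo_comp f g : is_homeo (f \o g).
Proof.
have [cf [f' [cf' fK f'K]]] := homeoP f.
have [cg [g' [cg' gK g'K]]] := homeoP g.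
split; first by move=> x; exact: continuous_comp (cg x) (cf _).
exists (g' \o f'); split; [|exact: can_comp|exact: can_comp].
by move=> x; exact: continuous_comp (cf' x) (cg' _).
Qed.

Definition homeo_inv_fun f : T -> T := sval (cid (homeoP f).2).

Fact homeo_inv_funP f :
  [/\ continuous (homeo_inv_fun f), cancel f (homeo_inv_fun f)
    & cancel (homeo_inv_fun f) f].
Proof. exact: svalP (cid (homeoP f).2). Qed.

Fact is_homeo_inv f : is_homeo (homeo_inv_fun f).
Proof.
have [cf' fK f'K] := homeo_inv_funP f.
by split=> //; exists f; split=> //; exact: (homeoP f).1.
Qed.

Definition homeo_one : homeo T := Homeo is_homeo_id.
Definition homeo_mul f g : homeo T := Homeo (is_homeo_comp f g).
Definition homeo_inv f : homeo T := Homeo (is_homeo_inv f).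

Fact homeo_mulA : associative homeo_mul.
Proof. by move=> f g h; exact: homeo_ext. Qed.

Fact homeo_mul1g : left_id homeo_one homeo_mul.
Proof. by move=> f; exact: homeo_ext. Qed.

Fact homeo_mulg1 : right_id homeo_one homeo_mul.
Proof. by move=> f; exact: homeo_ext. Qed.

Fact homeo_mulVg : left_inverse homeo_one homeo_inv homeo_mul.
Proof. by move=> f; apply: homeo_ext; have [] := homeo_inv_funP f. Qed.

Fact homeo_mulgV : right_inverse homeo_one homeo_inv homeo_mul.
Proof. by move=> f; apply: homeo_ext; have [] := homeo_inv_funP f. Qed.

HB.instance Definition _ := isGroup.Build (homeo T)
  homeo_mulA homeo_mul1g homeo_mulg1 homeo_mulVg homeo_mulgV.

End HomeoGroup.

Section Thompson.
Variable R : realType.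
Local Open Scope ring_scope.

(* A subtype of [R], with the subspace topology. *)
Definition unit_interval : topologicalType := set_type `[0 : R, 1].
Local Notation I := unit_interval.
Definition unit_val (x : I) : R := set_val x.
Local Notation val := unit_val.

Definition dyadic (x : R) : Prop :=
  exists (m : int) (n : nat), x = m%:~R / 2 ^+ n.

Definition increasing (f : I -> I) : Prop :=
  forall x y : I, val x < val y -> val (f x) < val (f y).

(* The breakpoints of [f] lie in a finite set [B] of dyadic points of (0, 1):
   on every interval whose interior avoids [B], [f] is affine and its slope is
   a power of 2 with exponent in [int]. *)
Definition dyadic_piecewise_linear (f : I -> I) : Prop :=
  exists B : set R,
    [/\ finite_set B, forall b, B b -> dyadic b /\ 0 < b < 1
      & forall u v : R, 0 <= u -> u < v -> v <= 1 ->
          (forall b, B b -> ~ (u < b < v)) ->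
          exists (k : int) (c : R), forall x : I, u <= val x <= v ->
            val (f x) = 2 ^ k * val x + c].

Definition thompson_set : set (homeo I) :=
  [set f | increasing f /\ dyadic_piecewise_linear f].

Fact dyadic0 : dyadic 0.
Proof. by exists 0, 0%N; rewrite mul0r. Qed.

Fact dyadicD x y : dyadic x -> dyadic y -> dyadic (x + y).
Proof.
move=> [m [n ->]] [m' [n' ->]].
exists (m * (2 : int) ^+ n' + m' * (2 : int) ^+ n), (n + n')%N.
by rewrite intrD !intrM exprD !rmorphXn /= addf_div ?expf_neq0 ?pnatr_eq0.
Qed.

Fact dyadicN x : dyadic x -> dyadic (- x).
Proof. by move=> [m [n ->]]; exists (- m), n; rewrite mulrNz mulNr. Qed.

Fact dyadicZ (k : int) x : dyadic x -> dyadic (2 ^ k * x).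
Proof.
move=> [m [n ->]]; case: k => k.
  by exists ((2 : int) ^+ k * m), n; rewrite intrM rmorphXn /= mulrA -exprnP.
exists m, (n + k.+1)%N.
by rewrite NegzE -exprnN exprD invfM [RHS]mulrA mulrC.
Qed.

Fact unit_intervalP (x : I) : 0 <= val x <= 1.
Proof. by have := set_valP x; rewrite /= in_itv. Qed.

Fact unit_interval_inj (x y : I) : val x = val y -> x = y.
Proof. by move=> xy; apply: val_inj; rewrite -set_valE. Qed.

Fact unit_interval_ex (r : R) : 0 <= r <= 1 -> exists x : I, val x = r.
Proof.
move=> r01; have Ir : `[0, 1]%classic r by rewrite /= in_itv.
by exists (SigSub (mem_set Ir)); rewrite /unit_val set_valE.
Qed.

Fact increasing_lt (f : I -> I) : increasing f ->
  forall x y, (val (f x) < val (f y)) = (val x < val y).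
Proof.
move=> fi x y; apply/idP/idP => [fxy|]; last exact: fi.
have [//|/fi yx|/unit_interval_inj xy] := ltgtP (val x) (val y).
  by have := lt_trans fxy yx; rewrite ltxx.
by move: fxy; rewrite xy ltxx.
Qed.

Fact increasing_le (f : I -> I) : increasing f ->
  forall x y, (val (f x) <= val (f y)) = (val x <= val y).
Proof. by move=> fi x y; rewrite !leNgt increasing_lt. Qed.

Fact homeo_surj (f : homeo I) (y : I) : exists x, f x = y.
Proof. by have [_ _ fK] := homeo_inv_funP f; exists (homeo_inv_fun f y). Qed.

Fact increasing0 (f : homeo I) (x : I) :
  increasing f -> val x = 0 -> val (f x) = 0.
Proof.
move=> fi x0; have [|z z0] := @unit_interval_ex 0; first by rewrite lexx ler01.
have [y fy] := homeo_surj f z; apply/eqP.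
have /andP[fx0 _] := unit_intervalP (f x).
have /andP[y0 _] := unit_intervalP y.
by rewrite eq_le fx0 andbT -z0 -fy increasing_le // x0.
Qed.

Fact increasing1 (f : homeo I) (x : I) :
  increasing f -> val x = 1 -> val (f x) = 1.
Proof.
move=> fi x1; have [|z z1] := @unit_interval_ex 1; first by rewrite lexx ler01.
have [y fy] := homeo_surj f z; apply/eqP.
have /andP[_ fx1] := unit_intervalP (f x).
have /andP[_ y1] := unit_intervalP y.
by rewrite eq_le fx1 /= -z1 -fy increasing_le // x1.
Qed.

Fact seq_max (s : seq R) :
  s = [::] \/ exists2 b, b \in s & forall c, c \in s -> c <= b.
Proof.
elim: s => [|a s [->|[b bs bmax]]]; [by left|right|right].
  by exists a => [|c]; [exact: mem_head|rewrite mem_seq1 => /eqP ->; rewrite lexx].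
exists (Num.max a b).
  by rewrite inE; case: (leP a b); rewrite ?bs ?orbT ?eqxx.
move=> c; rewrite inE le_max => /orP[/eqP ->|/bmax ->]; first by rewrite lexx.
by rewrite orbT.
Qed.

Fact count_ltn (a1 a2 : pred R) (b : R) (s : seq R) :
  subpred a1 a2 -> b \in s -> ~~ a1 b -> a2 b -> (count a1 s < count a2 s)%N.
Proof.
move=> a12 bs a1b a2b; elim: s bs => //= c s IHs.
rewrite inE => /orP[/eqP <-|/IHs lts].
  by rewrite a2b (negbTE a1b) ltnS sub_count.
by rewrite -addnS leq_add //; case: (boolP (a1 c)) => // /a12 ->.
Qed.

Fact thompson_dyadic (f : homeo I) : thompson_set f ->
  forall x : I, dyadic (val x) <-> dyadic (val (f x)).
Proof.
move=> [fi [B [/finite_seqP[s ->] B01 Baff]]] x.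
have [n] := ubnP (count (fun b => b < val x) s); elim: n x => // n IHn x.
rewrite ltnS => xn; have /andP[x0 x1] := unit_intervalP x.
have [x_eq0|xN0] := eqVneq (val x) 0.
  by rewrite x_eq0 increasing0 //; split=> _; exact: dyadic0.
have x_gt0 : 0 < val x by rewrite lt_neqAle eq_sym xN0.
suff [p [px pP pB]] : exists p : I, [/\ val p < val x,
    dyadic (val p) <-> dyadic (val (f p)) & dyadic (val p) /\
    forall b, b \in s -> ~ (val p < b < val x)].
  have [dp ps] := pB; have /andP[p0 _] := unit_intervalP p.
  have [k [c kc]] := Baff _ _ p0 px x1 ps.
  have fp := kc p; rewrite lexx ltW // in fp; move/(_ isT): fp => fp.
  have fx := kc x; rewrite lexx ltW // in fx; move/(_ isT): fx => fx.
  have dfp : dyadic (val (f p)) by apply/pP.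
  have kN0 : (2 : R) ^ k != 0 by rewrite expfz_neq0 // pnatr_eq0.
  split=> dx.
    have -> : val (f x) = val (f p) + 2 ^ k * (val x + - val p).
      by rewrite fx fp; ring.
    by apply: dyadicD => //; apply: dyadicZ; apply: dyadicD => //; exact: dyadicN.
  have -> : val x = val p + 2 ^ (- k) * (val (f x) + - val (f p)).
    by rewrite fx fp -invr_expz; field.
  by apply: dyadicD => //; apply: dyadicZ; apply: dyadicD => //; exact: dyadicN.
have [s0|[b]] := seq_max [seq b <- s | b < val x].
  have [|p p0] := @unit_interval_ex 0; first by rewrite lexx ler01.
  exists p; rewrite p0 increasing0 //; split=> //; split; first exact: dyadic0.
  move=> b bs /andP[_ bx].
  have : b \in [seq b <- s | b < val x] by rewrite mem_filter bx.
  by rewrite s0.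
rewrite mem_filter => /andP[bx bs] bmax.
have [db /andP[b0 b1]] := B01 _ bs.
have [|p pb] := @unit_interval_ex b; first by rewrite !ltW.
exists p; rewrite pb; split=> //.
  rewrite -pb; apply: IHn; apply: leq_trans xn.
  rewrite pb; apply: (count_ltn _ bs) => [c cb||//]; last by rewrite ltxx.
  exact: lt_trans cb bx.
split=> // c cs /andP[bc cx].
have /bmax : c \in [seq b <- s | b < val x] by rewrite mem_filter cx.
by rewrite leNgt bc.
Qed.

Fact thompson_subgroup : is_subgroup thompson_set.
Proof.
split.
- split; first by move=> x y.
  exists set0; split=> // u v *; exists 0, 0 => x _.
  by rewrite expr0z mul1r addr0.
- move=> f g fF gF; have [fi [Bf [finf Bf01 faff]]] := fF.
  have [gi [Bg [fing Bg01 gaff]]] := gF.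
  split; first by move=> x y /gi /fi.
  exists (Bg `|` val @` [set x | Bf (val (g x))]); split.
  + rewrite finite_setU; split=> //; apply: finite_image.
    apply: (@finite_preimage _ _ Bf (fun x => val (g x))) finf.
    move=> x y _ _ /unit_interval_inj; have [_ gK _] := homeo_inv_funP g.
    exact: (can_inj gK).
  + move=> b [/Bg01 //|[x Bfgx <-]].
    have [dgx /andP[gx0 gx1]] := Bf01 _ Bfgx.
    split; first by apply/(thompson_dyadic gF).
    have /andP[x0 x1] := unit_intervalP x.
    rewrite !lt_neqAle x0 x1 !andbT; apply/andP; split; apply/eqP => xE.
      by move: gx0; rewrite increasing0 ?ltxx.
    by move: gx1; rewrite increasing1 ?ltxx.
  + move=> u v u0 uv v1 avoid.
    have [|k [c kc]] := gaff u v u0 uv v1.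
      by move=> b Bgb; apply: avoid; left.
    have [|u' uE] := @unit_interval_ex u; first by rewrite u0 (le_trans (ltW uv)).
    have [|v' vE] := @unit_interval_ex v; first by rewrite v1 (le_trans u0 (ltW uv)).
    have /andP[gu0 _] := unit_intervalP (g u').
    have /andP[_ gv1] := unit_intervalP (g v').
    have [||k' [c' kc']] := faff _ _ gu0 _ gv1.
    * by rewrite increasing_lt // uE vE.
    * move=> b Bfb; have [_ /andP[b0 b1]] := Bf01 _ Bfb.
      have [|b' bE] := @unit_interval_ex b; first by rewrite !ltW.
      have [x gx] := homeo_surj g b'.
      rewrite -bE -gx !increasing_lt // uE vE; apply: avoid; right.
      by exists x => //=; rewrite gx bE.
    exists (k' + k), (2 ^ k' * c + c') => x uxv.
    rewrite expfzDr ?pnatr_eq0 // -mulrA addrA -mulrDr -kc //; apply: kc'.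
    by rewrite !increasing_le // uE vE.
- move=> f fF; have [fi [B [finB B01 aff]]] := fF.
  have [_ fK gK] := homeo_inv_funP f.
  have fVK x : f ((f^-1)%g x) = x by exact: gK.
  split.
    by move=> x y xy; rewrite -(increasing_lt fi) !fVK.
  exists ((fun x => val (f x)) @` [set x | B (val x)]); split.
  + apply: finite_image; apply: (@finite_preimage _ _ B val) finB.
    by move=> x y _ _ /unit_interval_inj.
  + move=> b [x Bx <-]; have [dx /andP[x0 x1]] := B01 _ Bx.
    split; first exact: ((thompson_dyadic fF x).1 dx).
    have [|z z0] := @unit_interval_ex 0; first by rewrite lexx ler01.
    have [|o o1] := @unit_interval_ex 1; first by rewrite lexx ler01.
    have := increasing_lt fi z x; rewrite (increasing0 fi z0) z0 => ->.
    by have := increasing_lt fi x o; rewrite (increasing1 fi o1) o1 x0 => ->.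
  + move=> u v u0 uv v1 avoid.
    have [|u' uE] := @unit_interval_ex u; first by rewrite u0 (le_trans (ltW uv)).
    have [|v' vE] := @unit_interval_ex v; first by rewrite v1 (le_trans u0 (ltW uv)).
    have [u'' fu] := homeo_surj f u'; have [v'' fv] := homeo_surj f v'.
    have /andP[gu0 _] := unit_intervalP u''.
    have /andP[_ gv1] := unit_intervalP v''.
    have [||k [c kc]] := aff _ _ gu0 _ gv1.
    * by rewrite -(increasing_lt fi) fu fv uE vE.
    * move=> b Bb; have [_ /andP[b0 b1]] := B01 _ Bb.
      have [|b' bE] := @unit_interval_ex b; first by rewrite !ltW.
      rewrite -bE -(increasing_lt fi u'') -(increasing_lt fi b' v'').
      rewrite fu fv uE vE; apply: avoid.
      by exists b' => //=; rewrite bE.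
    exists (- k), (- (2 ^ (- k) * c)) => y uyv.
    have := kc ((f^-1)%g y); rewrite -(increasing_le fi u'').
    rewrite -(increasing_le fi _ v'') fVK fu fv uE vE.
    move=> /(_ uyv) ->; rewrite -invr_expz.
    have kN0 : (2 : R) ^ k != 0 by rewrite expfz_neq0 // pnatr_eq0.
    by field.
Qed.

Definition thompsonF : groupType := Subgroup thompson_subgroup.

End Thompson.

(* Main.v *)
Require Import Defs.
From HB Require Import structures.
From mathcomp Require Import all_boot all_order all_algebra.
From mathcomp Require Import boolp classical_sets functions cardinality.
From mathcomp Require Import reals topology normedtype ring lra zify.

(** Let [x] be the element of Thompson's group [F] with slopes 2, 1, 1/2 on
    [[0, 1/4]], [[1/4, 1/2]], [[1/2, 1]]. It shifts the tiling of the open unit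
    interval by ..., [[1/8, 1/4]], [[1/4, 1/2]], [[1/2, 3/4]], [[3/4, 7/8]], ....
    Let [g] be the copy of [x] on [J = [1/4, 1/2]], and [f] an element of slope
    1/2 at 0 and at 1 that expands one of the tiles of [J] affinely onto [J], so
    that the intervals [f ^ n (J)] increase to the open unit interval. The
    subgroup [B] generated by [f] and [g] is the Brin-Navas group, and [K]
    consists of the elements with equal slopes at 0 and 1. The difference of the
    exponents of these slopes is a homomorphism onto the integers with kernel
    [K].

    Maximality. Multiplying by powers of [f] on both sides brings an element of
    [K] into a copy, supported in [J], of an element [phi] of [F], which is given
    by a pair of trees ([balanced_shrink], [tree_pair]). Tiling [J], its tiles,
    the tiles of these and so on, one labels the dyadic subintervals of [J] by
    [Full] (the tiles of all levels) or by [Lft], [Rgt] (their initial and final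
    pieces). Conjugates of [g] in [B] are copies of [x] on all [Full] intervals.
    If corresponding leaves of the two trees of [phi] have the same labels, then
    [phi] is a product of such copies ([sim_word]), so the element lies in [B].
    Otherwise it carries some interval onto one with another label, and
    conjugating by it one gets the copies of [x] on all dyadic subintervals of
    [J] ([mismatch_all_rot], which uses the pentagon relation). These generate
    the copy of [F] on [J] ([sim_full]), and together with [f] all of [K].
    Finite generation comes for free: [K] is generated by [B] and any one of its
    elements outside [B], and [F] by [K] and an element outside it that generates
    the quotient.

    Elementary amenability. An element of [B] is, up to powers of [f] on both
    sides, a copy on [J] of an element that permutes the tiles of the first [k]
    levels for some [k] and is affine on those of level [k]. Such elements form a
    solvable group ([tower]): the subgroups fixing all tiles of level [j] have
    abelian successive quotients, as order-preserving permutations of a tiling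
    commute. So [B] lies in an extension of a directed union of solvable groups
    by a cyclic group. The same description shows that the copy of [x] on an
    interval labelled [Lft] is not in [B], whence [B] is a proper subgroup. *)

Set Implicit Arguments.
Unset Strict Implicit.
Unset Printing Implicit Defensive.

Import Order.TTheory GRing.Theory Num.Theory.
Import numFieldNormedType.Exports.

Local Open Scope classical_set_scope.
Local Open Scope quotient_scope.

(** * Generation and elementary amenability *)

Section Generation.
Variable G : groupType.
Implicit Types (S T : set G) (H N : subgroup G).
Local Open Scope group_scope.

Lemma generated_is_subgroup S : is_subgroup (generated S).
Proof.
split=> [M [[]] //|x y Sx Sy M [MG SM]|x Sx M [MG SM]].
  by have [_ MM _] := MG; apply: MM; [apply: Sx|apply: Sy].
by have [_ _ MV] := MG; apply: MV; apply: Sx.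
Qed.

Definition generated_subgroup S : subgroup G :=
  Subgroup (generated_is_subgroup S).

Lemma sub_generated S : S `<=` generated S.
Proof. by move=> x Sx M [_]; apply. Qed.

Lemma generated_sub S H : S `<=` H -> generated S `<=` H.
Proof. by move=> SH x; apply; split=> //; exact: subgroupP. Qed.

Lemma subgroup1 H : (H : set G) 1.
Proof. by case: (subgroupP H). Qed.

Lemma subgroupM H x y : (H : set G) x -> (H : set G) y -> (H : set G) (x * y).
Proof. by case: (subgroupP H) => _ HM _; apply: HM. Qed.

Lemma subgroupV H x : (H : set G) x -> (H : set G) x^-1.
Proof. by case: (subgroupP H) => _ _ HV; apply: HV. Qed.

Lemma subgroupX H x n : (H : set G) x -> (H : set G) (x ^+ n).
Proof.
move=> Hx; elim: n => [|n IHn]; first by rewrite expg0; exact: subgroup1.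
by rewrite expgS; exact: subgroupM.
Qed.

Lemma subgroupMr H x y : (H : set G) x ->
  (H : set G) (y * x) <-> (H : set G) y.
Proof.
move=> Hx; split=> [Hyx|Hy]; last exact: subgroupM.
by rewrite -(mulgK x y); apply: subgroupM => //; exact: subgroupV.
Qed.

Lemma subgroupMl H x y : (H : set G) x ->
  (H : set G) (x * y) <-> (H : set G) y.
Proof.
move=> Hx; split=> [Hxy|Hy]; last exact: subgroupM.
by rewrite -(mulKg x y); apply: subgroupM => //; exact: subgroupV.
Qed.

Definition subgroup_elt H x (Hx : (H : set G) x) : H := exist _ x (mem_set Hx).

Lemma subgroup_valP H (x : H) : (H : set G) (val x).
Proof. exact: set_mem (valP x). Qed.

(** Generation inside the carrier of [H] is compared with generation in [G] by
    taking images of subgroups. *)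
Lemma finitely_generated_subgroup H S :
  finite_set S -> generated S = H -> finitely_generated H.
Proof.
move=> finS SH; exists [set x : H | S (val x)].
  by apply: finite_preimage finS => x y _ _; exact: val_inj.
apply/seteqP; split=> // x _ M [MG SM].
have M'G : is_subgroup (val @` M).
  have [M1 MM MV] := MG; split; first by exists 1.
    by move=> _ _ [y My <-] [z Mz <-]; exists (y * z); first exact: MM.
  by move=> _ [y My <-]; exists y^-1; first exact: MV.
have : generated S `<=` val @` M.
  apply: (@generated_sub _ (Subgroup M'G)) => y Sy.
  have Hy : (H : set G) y by rewrite -SH; exact: sub_generated.
  by exists (subgroup_elt Hy) => //; apply: SM.
by rewrite SH => /(_ _ (subgroup_valP x))[y My /val_inj <-].
Qed.

End Generation.

Section ElementaryAmenable.
Local Open Scope group_scope.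

(** Invariance under isomorphism, in a form where the isomorphism may be given by
    a formula on the ambient group. *)
Lemma ea_image (G G' : groupType) (H : subgroup G) (H' : subgroup G')
    (phi : G -> G') :
  {in (H : set G) &, {morph phi : x y / x * y}} ->
  {in (H : set G) &, injective phi} -> phi @` (H : set G) = H' ->
  elementary_amenable H -> elementary_amenable H'.
Proof.
move=> phiM phi_inj phiH.
have phiP (x : H) : (H' : set G') (phi (val x)).
  by rewrite -phiH; exists (val x) => //; exact: subgroup_valP.
pose f (x : H) : H' := subgroup_elt (phiP x).
have fM : {morph f : x y / x * y}.
  by move=> x y; apply: val_inj => /=; rewrite phiM ?(valP x) ?(valP y).
pose fm := isMultiplicative.Build H H' f fM.
pose F : {multiplicative H -> H'} := HB.pack f fm.
suff bijF : bijective F by exact: (@ea_isog _ _ F bijF).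
have /choice[g gP] : forall y : H', exists x, F x = y.
  move=> y; have [x Hx xy] : (phi @` (H : set G)) (val y).
    by rewrite phiH; exact: subgroup_valP.
  by exists (subgroup_elt Hx); apply: val_inj.
have F_inj : injective F.
  move=> x y /(congr1 val) /= /phi_inj xy; apply: val_inj.
  by apply: xy; exact: valP.
by exists g => // x; apply: F_inj; rewrite gP.
Qed.

Section Restriction.
Variables (G : groupType) (H : subgroup G).

Fact subgroup_in_subproof (N : subgroup G) :
  is_subgroup [set x : H | (N : set G) (val x)].
Proof.
split=> [|x y|x] /=; first exact: subgroup1.
  exact: subgroupM.
exact: subgroupV.
Qed.

Definition subgroup_in (N : subgroup G) : subgroup H :=
  Subgroup (subgroup_in_subproof N).

Lemma ea_subgroup_in (N : subgroup G) : N `<=` H ->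
  elementary_amenable N -> elementary_amenable (subgroup_in N).
Proof.
move=> NH; have valI x : (N : set G) x -> val (insubd (1 : H) x) = x.
  by move=> /NH/mem_set Hx; rewrite val_insubd /= Hx.
apply: (ea_image (phi := insubd (1 : H))).
- move=> x y /set_mem Nx /set_mem Ny; apply: val_inj => /=.
  by rewrite !valI //; exact: subgroupM.
- by move=> x y /set_mem Nx /set_mem Ny xy; rewrite -(valI x) // xy valI.
- apply/seteqP; split=> [_ [x Nx <-]|x Nx] /=; first by rewrite valI.
  by exists (val x) => //; apply: val_inj; rewrite valI.
Qed.

Lemma ea_subgroup_in_val (N : subgroup G) : N `<=` H ->
  elementary_amenable (subgroup_in N) -> elementary_amenable N.
Proof.
move=> NH; apply: (ea_image (phi := \val)) => //.
- by move=> x y _ _; exact: val_inj.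
- apply/seteqP; split=> [_ [x Nx <-] //|x Nx].
  by exists (subgroup_elt (NH _ Nx)).
Qed.

Lemma ea_sub (N : subgroup G) : N `<=` H ->
  elementary_amenable H -> elementary_amenable N.
Proof. by move=> NH eaH; apply/ea_subgroup_in_val/ea_subgroup. Qed.

(** Containing the commutators of [H] makes [N] normal, with abelian quotient. *)
Lemma ea_abelian_extension (N : subgroup G) : N `<=` H ->
  (forall x y, (H : set G) x -> (H : set G) y -> (N : set G) [~ x, y]) ->
  elementary_amenable N -> elementary_amenable H.
Proof.
move=> NH commN eaN.
have nN : normal (subgroup_in N).
  move=> h x Nx; rewrite -[x ^ h](mulVKg x) -commgEl.
  apply: subgroupM => //=; apply: commN; exact: subgroup_valP.
apply: (ea_extension (nN := nN)); first exact: ea_subgroup_in.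
apply: ea_abelian => u v; rewrite -[u]reprK -[v]reprK /commute.
transitivity (\pi_(quotient nN) (repr u * repr v));
  first by rewrite quotient_mulE.
transitivity (\pi_(quotient nN) (repr v * repr u));
  last by rewrite quotient_mulE.
apply/esym/quotient_eqP.
rewrite invgM -mulgA; apply: commN; exact: subgroup_valP.
Qed.

Lemma ea_directed_family (I : Type) (N : I -> subgroup G) (i0 : I) :
  (forall i j, exists k, N i `<=` N k /\ N j `<=` N k) ->
  (H : set G) = \bigcup_i (N i : set G) ->
  (forall i, elementary_amenable (N i)) -> elementary_amenable H.
Proof.
move=> dirN HN eaN; have NH i : N i `<=` H by rewrite HN => x Nix; exists i.
apply: (@ea_directed_union _ (range (fun i => subgroup_in (N i)))).
- by exists (subgroup_in (N i0)), i0.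
- move=> _ _ [i _ <-] [j _ <-]; have [k [ik jk]] := dirN i j.
  by exists (subgroup_in (N k)); split=> [|x /ik|x /jk] //; exists k.
- apply/seteqP; split=> // x _.
  have : (H : set G) (val x) by exact: subgroup_valP.
  by rewrite {1}HN => -[i _ Nix]; exists (subgroup_in (N i)) => //; exists i.
- by move=> _ [i _ <-]; exact: ea_subgroup_in.
Qed.

End Restriction.

Lemma ea_trivial (G : groupType) (H : subgroup G) :
  (forall x, (H : set G) x -> x = 1) -> elementary_amenable H.
Proof.
move=> H1; apply: ea_abelian => x y; apply: val_inj.
by rewrite /= (H1 _ (subgroup_valP x)) (H1 _ (subgroup_valP y)).
Qed.

End ElementaryAmenable.

(** * Gluing elements of Thompson's group *)

Section Interval.
Variable R : realType.
Local Open Scope ring_scope.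
Local Notation I := (unit_interval R).
Local Notation val := (@unit_val R).
Implicit Types (x y : I) (b : bool) (f g : I -> I).

Lemma unit_val_ge0 x : 0 <= val x. Proof. by case/andP: (unit_intervalP x). Qed.
Lemma unit_val_le1 x : val x <= 1. Proof. by case/andP: (unit_intervalP x). Qed.

(** Being total, it allows maps of the interval to be given by formulas on real
    numbers; the value 0 outside the interval is arbitrary. *)
Definition to_unit (r : R) : I :=
  if pselect (0 <= r <= 1) is left r01 then sval (cid (unit_interval_ex r01))
  else sval (cid (unit_interval_ex (introT andP (conj (lexx 0) ler01)))).

Lemma to_unitK r : 0 <= r <= 1 -> val (to_unit r) = r.
Proof. by rewrite /to_unit; case: pselect => // r01 _; case: cid. Qed.

Definition i0 := to_unit 0.
Definition i1 := to_unit 1.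

Lemma val_i0 : val i0 = 0. Proof. by rewrite to_unitK ?lexx ?ler01. Qed.
Lemma val_i1 : val i1 = 1. Proof. by rewrite to_unitK ?lexx ?ler01. Qed.

Lemma continuous_unit_val : continuous val.
Proof. exact: (@initial_continuous _ _ (@set_val R `[0, 1])). Qed.

(** By surjectivity [f x - e] and [f x + e] are values of [f], unless they lie
    outside the interval, and the points where they are taken bound a
    neighbourhood of [x]. *)
Lemma increasing_continuous f : increasing f -> (forall y, exists x, f x = y) ->
  continuous f.
Proof.
move=> fi f_surj; have main : continuous (fun x => val (f x)); last first.
  by apply: (@continuous_comp_initial _ I _ set_val).
move=> x.
apply/(@cvgrPdist_lt R R^o I (nbhs x) (nbhs_filter x)) => e e0.
have FF : Filter (nbhs x) := nbhs_filter x;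
  have f_at r : 0 <= r <= 1 -> exists p, val (f p) = r.
  move=> r01; have [p fp] := f_surj (to_unit r).
  by exists p; rewrite fp to_unitK.
have val_gt r : r < val x -> \forall t \near x, r < val t.
  by move=> rx; exact: (continuous_unit_val (lt_nbhsr rx)).
have val_lt r : val x < r -> \forall t \near x, val t < r.
  by move=> rx; exact: (continuous_unit_val (lt_nbhsl rx)).
have lower : \forall t \near x, val (f x) - e < val (f t).
  have [fxe|fxe] := ltP (val (f x) - e) 0.
    by apply: (@filterE _ _ FF) => t; exact: lt_le_trans fxe (unit_val_ge0 _).
  have [|p fp] := f_at (val (f x) - e).
    by rewrite fxe lerBlDr (le_trans (unit_val_le1 _)) ?lerDl ?ltW.
  have /val_gt : val p < val x.
    by rewrite -(increasing_lt fi) fp ltrBlDr ltrDl.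
  by apply: (@filterS _ _ FF) => t; rewrite -fp increasing_lt.
have upper : \forall t \near x, val (f t) < val (f x) + e.
  have [fxe|fxe] := ltP 1 (val (f x) + e).
    by apply: (@filterE _ _ FF) => t; exact: le_lt_trans (unit_val_le1 _) fxe.
  have [|p fp] := f_at (val (f x) + e).
    by rewrite fxe addr_ge0 ?unit_val_ge0 ?ltW.
  have /val_lt : val x < val p.
    by rewrite -(increasing_lt fi) fp ltrDl.
  by apply: (@filterS _ _ FF) => t; rewrite -fp increasing_lt.
apply: (@filterS2 _ _ FF _ _ _ _ lower upper) => t ft_gt ft_lt.
by rewrite distrC ltr_distl ft_gt.
Qed.

Lemma increasing_cancel f g : increasing f -> cancel g f -> increasing g.
Proof. by move=> fi gK x y xy; rewrite -(increasing_lt fi) !gK. Qed.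

Lemma increasing_is_homeo f g : increasing f -> cancel f g -> cancel g f ->
  is_homeo f.
Proof.
move=> fi fK gK; have gi := increasing_cancel fi gK.
split; first by apply: increasing_continuous => // y; exists (g y).
by exists g; split=> //; apply: increasing_continuous => // y; exists (f y).
Qed.

(** The left half is selected by [false], the right one by [true]; [unhalve b]
    inverts [halve b] on the half selected by [b] only. *)
Definition halve b x : I := to_unit ((b%:R + val x) / 2).
Definition unhalve b x : I := to_unit (2 * val x - b%:R).

Lemma val_halve b x : val (halve b x) = (b%:R + val x) / 2.
Proof.
have := unit_val_ge0 x; have := unit_val_le1 x => x1 x0.
by rewrite to_unitK //; case: b => /=; apply/andP; split; lra.
Qed.

Lemma val_unhalve b x : b%:R / 2 <= val x <= (1 + b%:R) / 2 ->
  val (unhalve b x) = 2 * val x - b%:R.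
Proof. by move=> /andP[bx xb]; rewrite to_unitK //; apply/andP; split; lra. Qed.

Lemma halve_bounds b x : b%:R / 2 <= val (halve b x) <= (1 + b%:R) / 2.
Proof.
have := unit_val_ge0 x; have := unit_val_le1 x => x1 x0.
by rewrite val_halve; apply/andP; split; lra.
Qed.

Lemma halveK b : cancel (halve b) (unhalve b).
Proof.
move=> x; apply: unit_interval_inj; rewrite val_unhalve ?halve_bounds //.
by rewrite val_halve; lra.
Qed.

Lemma unhalveK b x : b%:R / 2 <= val x <= (1 + b%:R) / 2 -> halve b (unhalve b
  x) = x.
Proof.
move=> bx; apply: unit_interval_inj; rewrite val_halve val_unhalve //; lra.
Qed.

Lemma halve_inj b : injective (halve b). Proof. exact: can_inj (halveK b). Qed.

Lemma halve0 : halve false i0 = i0.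
Proof. by apply: unit_interval_inj; rewrite val_halve val_i0 /=; lra. Qed.

Lemma halve1 : halve true i1 = i1.
Proof. by apply: unit_interval_inj; rewrite val_halve val_i1 /=; lra. Qed.

Lemma halve_mid : halve false i1 = halve true i0.
Proof. by apply: unit_interval_inj; rewrite !val_halve val_i1 val_i0 /=;
  lra. Qed.

Lemma halve_overlap x y : halve false x = halve true y -> x = i1 /\ y = i0.
Proof.
move=> /(congr1 val); rewrite !val_halve /=.
have := unit_val_le1 x; have := unit_val_ge0 y => y0 x1 xy.
by split; apply: unit_interval_inj; rewrite ?val_i0 ?val_i1; lra.
Qed.

Lemma halve_cover x : exists b y, x = halve b y.
Proof.
have := unit_val_ge0 x; have := unit_val_le1 x => x1 x0.
exists (2^-1 < val x), (unhalve (2^-1 < val x) x); rewrite unhalveK //.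
by case: ltP => /= x2; apply/andP; split; lra.
Qed.

Lemma i0_neq_i1 : i0 <> i1.
Proof. by move=> /(congr1 val)/eqP; rewrite val_i0 val_i1 eq_sym oner_eq0. Qed.

Definition act (h : thompsonF R) : I -> I := \val h.

Implicit Types h k : thompsonF R.

Lemma thompson_ext h k : act h =1 act k -> h = k.
Proof. by move=> hk; apply: val_inj; apply: homeo_ext. Qed.

Lemma actM h k x : act (h * k)%g x = act h (act k x). Proof. by []. Qed.

Lemma actKV h x : act h (act h^-1%g x) = x.
Proof. by rewrite -actM mulgV. Qed.

Lemma actVK h x : act h^-1%g (act h x) = x.
Proof. by rewrite -actM mulVg. Qed.

Lemma act_thompson h : thompson_set (\val h).
Proof. exact: (@subgroup_valP _ (Subgroup (@thompson_subgroup R))). Qed.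

Lemma act_increasing h : increasing (act h).
Proof. by case: (act_thompson h). Qed.

Lemma act_i0 h : act h i0 = i0.
Proof.
apply: unit_interval_inj; rewrite val_i0;
  apply: increasing0 (act_increasing h) _.
exact: val_i0.
Qed.

Lemma act_i1 h : act h i1 = i1.
Proof.
apply: unit_interval_inj; rewrite val_i1;
  apply: increasing1 (act_increasing h) _.
exact: val_i1.
Qed.

Lemma act_surjective f g : increasing f -> cancel f g -> cancel g f ->
  dyadic_piecewise_linear f -> exists h, act h =1 f.
Proof.
move=> fi fK gK fpl; pose F := Homeo (increasing_is_homeo fi fK gK).
have FT : thompson_set F by split.
by exists (subgroup_elt (H := Subgroup (@thompson_subgroup R)) FT).
Qed.

Lemma dyadic_halve (r : R) : dyadic r -> dyadic (r / 2).
Proof.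
move=> dr; have -> : r / 2 = 2 ^ (-1) * r by rewrite mulrC.
exact: dyadicZ.
Qed.

Section Glue.
Variable phi : bool -> thompsonF R.

(** The two halves share the midpoint, where both formulas agree because elements
    of the group fix the ends of the interval. *)
Definition glue x : I :=
  halve (2^-1 < val x) (act (phi (2^-1 < val x)) (unhalve (2^-1 < val x) x)).

Lemma glue_halve b x : glue (halve b x) = halve b (act (phi b) x).
Proof.
rewrite /glue; case: ltP => [xb|xb]; case: b xb => xb; rewrite ?halveK //.
  by have := halve_bounds false x; move: xb => /= xb /andP[_ xb']; exfalso; lra.
have <- : i0 = x.
  apply: unit_interval_inj; have := unit_val_ge0 x; move: xb;
    rewrite val_halve val_i0.
  by move=> /= ? ?; lra.
by rewrite -halve_mid halveK act_i0 act_i1 halve_mid.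
Qed.

Lemma glue_increasing : increasing glue.
Proof.
move=> x y; have [b [x' ->]] := halve_cover x;
  have [c [y' ->]] := halve_cover y.
have fx1 := unit_val_le1 (act (phi b) x').
have fy0 := unit_val_ge0 (act (phi c) y').
have x'0 := unit_val_ge0 x'; have y'0 := unit_val_ge0 y'.
have x'1 := unit_val_le1 x'; have y'1 := unit_val_le1 y'.
have fx_lt1 : val x' < 1 -> val (act (phi b) x') < 1.
  rewrite -{2}val_i1 -(act_i1 (phi b)) => x_lt1.
  by apply: act_increasing; rewrite val_i1.
have fy_gt0 : 0 < val y' -> 0 < val (act (phi c) y').
  rewrite -{2}val_i0 -(act_i0 (phi c)) => y_gt0.
  by apply: act_increasing; rewrite val_i0.
rewrite !glue_halve !val_halve.
case: b fx_lt1 fx1; case: c fy_gt0 fy0 => /= fy_gt0 fy0 fx_lt1 fx1 xy; try lra.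
- have /act_increasing : val x' < val y' by lra.
  by move=> /(_ (phi true)); lra.
- have /act_increasing : val x' < val y' by lra.
  by move=> /(_ (phi false)); lra.
Qed.

(** The midpoint becomes a breakpoint, the others are those of the two factors,
    rescaled. *)
Definition glue_breaks : set R :=
  [set 2^-1] `|` \bigcup_b
    [set (b%:R + r) / 2 | r in sval (cid (act_thompson (phi b)).2)].

Lemma glue_pl : dyadic_piecewise_linear glue.
Proof.
exists glue_breaks; split.
- rewrite finite_setU; split=> //; apply: bigcup_finite => // b _.
  by apply: finite_image; case: cid => B [].
- move=> r [->|[b _ [r' + <-]]].
    split; last by apply/andP; split; lra.
    by exists 1, 1%N; rewrite mul1r expr1.
  case: cid => B [_ /= B01 _] /B01[dr /andP[r0 r1]]; split.
    apply: dyadic_halve; apply: dyadicD => //.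
    by exists b%:Z, 0%N; rewrite expr0 divr1.
  by case: b; apply/andP; split => /=; lra.
- move=> u v u0 uv v1 avoid.
  have [b [bu vb]] : exists b : bool, b%:R / 2 <= u /\ v <= (1 + b%:R) / 2.
    have [hu|uh] := leP 2^-1 u; first by exists true; rewrite /=; split; lra.
    have [vh|hv] := leP v 2^-1; first by exists false; rewrite /=; split; lra.
    by case: (avoid 2^-1); [left|rewrite uh].
  have : forall r, sval (cid (act_thompson (phi b)).2) r ->
      ~ (2 * u - b%:R < r < 2 * v - b%:R).
    move=> r Br /andP[ur rv]; apply: (avoid ((b%:R + r) / 2)).
      by right; exists b => //; exists r.
    by apply/andP; split; lra.
  case: cid => B [_ _ /= aff] avoidB.
  have [|||k [c kc]] := aff (2 * u - b%:R) (2 * v - b%:R) _ _ _ avoidB; try lra.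
  exists k, ((b%:R + c - 2 ^ k * b%:R) / 2) => x /andP[ux xv].
  have bx : b%:R / 2 <= val x <= (1 + b%:R) / 2 by apply/andP; split; lra.
  rewrite -{1}(unhalveK bx) glue_halve val_halve kc val_unhalve //; last first.
    by apply/andP; split; lra.
  by field.
Qed.

End Glue.

Lemma act_glue_exists (phi : bool -> thompsonF R) :
  exists h, forall b x, act h (halve b x) = halve b (act (phi b) x).
Proof.
have glueK (f g : bool -> thompsonF R) : (forall b,
  cancel (act (f b)) (act (g b))) ->
    cancel (glue f) (glue g).
  move=> fg x; have [b [y ->]] := halve_cover x.
  by rewrite !glue_halve fg.
have [||||h hE] := @act_surjective (glue phi) (glue (fun b => (phi b)^-1%g)).
- exact: glue_increasing.
- by apply: glueK => b x; rewrite actVK.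
- by apply: glueK => b x; rewrite actKV.
- exact: glue_pl.
- by exists h => b x; rewrite hE glue_halve.
Qed.

Definition halves phi : thompsonF R := sval (cid (act_glue_exists phi)).

Lemma act_halves phi b x : act (halves phi) (halve b x) = halve b (act (phi b)
  x).
Proof. by rewrite /halves; case: cid. Qed.

(** An element fixing [1/2] preserves both halves and, rescaled, restricts to
    an element of the group on each of them. *)
Lemma halves_of_fix_mid h : act h (halve false i1) = halve false i1 ->
  exists phi, h = halves phi.
Proof.
move=> h_mid.
have halve_le b x y : (val (halve b x) <= val (halve b y)) = (val x <= val y).
  by rewrite !val_halve ler_pM2r ?invr_gt0 // lerD2l.
have range k b x : act k (halve false i1) = halve false i1 ->
    halve b (unhalve b (act k (halve b x))) = act k (halve b x).
  move=> k_mid; apply: unhalveK.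
  have kle y z : val y <= val z -> val (act k y) <= val (act k z).
    by rewrite (increasing_le (@act_increasing k)).
  have val_mid : val (halve false i1) = 2^-1 by rewrite val_halve val_i1 /=;
    lra.
  have := unit_val_ge0 (act k (halve b x));
    have := unit_val_le1 (act k (halve b x)).
  have := halve_bounds b x => /andP[]; case: b => /= bx xb k1 k0.
    have := kle (halve false i1) (halve true x); rewrite k_mid val_mid => kx.
    by have {}kx := kx ltac:(lra); apply/andP; split; lra.
  have := kle (halve false x) (halve false i1); rewrite k_mid val_mid => kx.
  by have {}kx := kx ltac:(lra); apply/andP; split; lra.
have hV_mid : act h^-1%g (halve false i1) = halve false i1 by rewrite -{1}h_mid
  actVK.
suff /choice[phi phiE] : forall b, exists k, forall x,
    halve b (act k x) = act h (halve b x).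
  exists phi; apply: thompson_ext => x; have [b [y ->]] := halve_cover x.
  by rewrite act_halves phiE.
move=> b; pose f x := unhalve b (act h (halve b x)).
pose g x := unhalve b (act h^-1%g (halve b x)).
have [||||k kf] := @act_surjective f g.
- move=> x y xy; rewrite /f ltNge -(halve_le b) !range // -ltNge.
  by apply: act_increasing; rewrite ltNge halve_le -ltNge.
- by move=> x; rewrite /f /g range // actVK halveK.
- by move=> x; rewrite /f /g range // actKV halveK.
- have [B [finB B01 aff]] := (act_thompson h).2.
  exists [set 2 * r - b%:R | r in B `&` [set r | b%:R / 2 < r < (1 + b%:R) /
    2]].
  split; first by apply: finite_image; apply: finite_setIl.
    move=> _ [r [/B01[dr _] /andP[br rb]] <-]; split.
      apply: dyadicD; first exact: (@dyadicZ _ 1).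
      by apply: dyadicN; exists b%:Z, 0%N; rewrite expr0 divr1.
    by apply/andP; split; lra.
  move=> u v u0 uv v1 avoid.
  have [||||k [c kc]] := aff ((b%:R + u) / 2) ((b%:R + v) / 2).
  + by case: (b) => /=; lra.
  + lra.
  + by case: (b) => /=; lra.
  + move=> r Br /andP[ur rv]; apply: (avoid (2 * r - b%:R)).
      by exists r => //; split=> //=; apply/andP; split; lra.
    by apply/andP; split; lra.
  exists k, (2 ^ k * b%:R + 2 * c - b%:R) => x /andP[ux xv].
  have fxE : (b%:R + val (f x)) / 2 = 2 ^ k * ((b%:R + val x) / 2) + c.
    rewrite -!val_halve /f range // kc // val_halve.
    by apply/andP; split; lra.
  have -> : val (f x) = 2 * ((b%:R + val (f x)) / 2) - b%:R by field.
  by rewrite fxE; field.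
- by exists k => x; rewrite kf /f range.
Qed.

(** One of the two standard generators of Thompson's group; the name [rotation]
    refers to its effect on trees, see [maps_seq_rot]. *)
Definition rot_fun (r : R) : R :=
  if r <= 4^-1 then 2 * r else if r <= 2^-1 then r + 4^-1 else (r + 1) / 2.

Definition rot_inv_fun (r : R) : R :=
  if r <= 2^-1 then r / 2 else if r <= 3 / 4 then r - 4^-1 else 2 * r - 1.

Lemma rot_exists : exists h, forall x, val (act h x) = rot_fun (val x).
Proof.
pose f x := to_unit (rot_fun (val x));
  pose g x := to_unit (rot_inv_fun (val x)).
have fE x : val (f x) = rot_fun (val x).
  rewrite /f to_unitK // /rot_fun.
  have := unit_val_ge0 x; have := unit_val_le1 x => x1 x0.
  by case: (leP (val x) 4^-1) => ?; [|case: (leP (val x) 2^-1) => ?];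
    apply/andP; split; lra.
have gE x : val (g x) = rot_inv_fun (val x).
  rewrite /g to_unitK // /rot_inv_fun.
  have := unit_val_ge0 x; have := unit_val_le1 x => x1 x0.
  by case: (leP (val x) 2^-1) => ?; [|case: (leP (val x) (3 / 4)) => ?];
    apply/andP; split; lra.
have [||||h hf] := @act_surjective f g.
- move=> x y; rewrite !fE /rot_fun => xy.
  by case: (leP (val x) 4^-1) => ?; [|case: (leP (val x) 2^-1) => ?];
    (case: (leP (val y) 4^-1) => ?; [|case: (leP (val y) 2^-1) => ?]); lra.
- move=> x; apply: unit_interval_inj; rewrite gE fE /rot_fun /rot_inv_fun.
  have := unit_val_ge0 x; have := unit_val_le1 x => x1 x0.
  by case: (leP (val x) 4^-1) => ?; [|case: (leP (val x) 2^-1) => ?];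
    case: leP => ?; try case: leP => ?; lra.
- move=> x; apply: unit_interval_inj; rewrite fE gE /rot_fun /rot_inv_fun.
  have := unit_val_ge0 x; have := unit_val_le1 x => x1 x0.
  by case: (leP (val x) 2^-1) => ?; [|case: (leP (val x) (3 / 4)) => ?];
    case: leP => ?; try case: leP => ?; lra.
- exists [set 4^-1; 2^-1]; split; first by rewrite finite_setU; split.
    move=> r [->|->]; split; try by apply/andP; split; lra.
      by exists 1, 2%N; rewrite mul1r -[in RHS]exprVn; field.
    by exists 1, 1%N; rewrite mul1r expr1.
  move=> u v u0 uv v1 avoid.
  have [v4|v4] := leP v 4^-1.
    exists 1, 0 => x /andP[ux xv]; rewrite fE /rot_fun expr1z addr0.
    by have -> : val x <= 4^-1 by lra.
  have u4 : 4^-1 <= u.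
    by rewrite leNgt; apply/negP => u4; apply: (avoid 4^-1); [left|rewrite u4].
  have [v2|v2] := leP v 2^-1.
    exists 0, 4^-1 => x /andP[ux xv]; rewrite fE /rot_fun expr0z mul1r.
    case: leP => x4; first lra.
    by have -> : val x <= 2^-1 by lra.
  have u2 : 2^-1 <= u.
    by rewrite leNgt; apply/negP => u2; apply: (avoid 2^-1); [right|rewrite u2].
  exists (-1), 2^-1 => x /andP[ux xv]; rewrite fE /rot_fun -[2 ^ -1]/(2^-1).
  by case: leP => x4; [|case: leP => x2]; lra.
- by exists h => x; rewrite hf fE.
Qed.

Definition rotation : thompsonF R := sval (cid rot_exists).

Lemma val_act_rot x : val (act rotation x) = rot_fun (val x).
Proof. by rewrite /rotation; case: cid. Qed.

Lemma rot_00 x : act rotation (halve false (halve false x)) = halve false x.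
Proof.
apply: unit_interval_inj; rewrite val_act_rot !val_halve /rot_fun /=.
have := unit_val_le1 x => x1; case: leP => ?; [|case: leP => ?]; lra.
Qed.

Lemma rot_01 x :
  act rotation (halve false (halve true x)) = halve true (halve false x).
Proof.
apply: unit_interval_inj; rewrite val_act_rot !val_halve /rot_fun /=.
have := unit_val_ge0 x; have := unit_val_le1 x => x1 x0.
by case: leP => ?; [|case: leP => ?]; lra.
Qed.

Lemma rot_1 x : act rotation (halve true x) = halve true (halve true x).
Proof.
apply: unit_interval_inj; rewrite val_act_rot !val_halve /rot_fun /=.
have := unit_val_ge0 x => x0.
by case: leP => ?; [|case: leP => ?]; lra.
Qed.

End Interval.

(** * Dyadic addresses and tree pairs *)

(** A tree is a subdivision of an interval into dyadic subintervals, which are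
    named by the paths from the root to the leaves. *)
Inductive tree := Leaf | Node of tree & tree.

Fixpoint leaves (s : tree) : seq (seq bool) :=
  if s is Node l r then map (cons false) (leaves l) ++ map (cons true) (leaves
    r)
  else [:: [::]].

Section Addresses.
Variable R : realType.
Local Notation I := (unit_interval R).
Local Notation val := (@unit_val R).
Local Notation i0 := (i0 R).
Local Notation i1 := (i1 R).
Implicit Types (x y : I) (h k : thompsonF R) (u v w p q : seq bool).

Fixpoint emb u x : I := if u is b :: v then halve b (emb v x) else x.

Lemma emb_cat u v x : emb (u ++ v) x = emb u (emb v x).
Proof. by elim: u => //= b u ->. Qed.

Lemma emb_inj u : injective (emb u).
Proof. by elim: u => //= b u IHu x y /halve_inj/IHu. Qed.

Lemma emb_i0_neq1 u : emb u i0 <> i1.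
Proof.
elim: u => [|[] u IHu] /=; first exact: i0_neq_i1.
  by rewrite -halve1 => /halve_inj.
by rewrite -halve1 => /halve_overlap[_ /esym/i0_neq_i1].
Qed.

Lemma emb_i1_neq0 u : emb u i1 <> i0.
Proof.
elim: u => [|[] u IHu] /=; first by move/esym/i0_neq_i1.
  by rewrite -halve0 => /esym/halve_overlap[/i0_neq_i1].
by rewrite -halve0 => /halve_inj.
Qed.

(** Otherwise the two dyadic intervals are nested the other way round, or their
    interiors are disjoint. *)
Lemma emb_sub_prefix u v : (forall x, exists y,
  emb u x = emb v y) -> prefix v u.
Proof.
elim: v u => [|b v IHv] [|c u] uv; rewrite ?prefix0s //=.
  case: b uv => uv.
    have [y] := uv i0; rewrite -halve0 => /halve_overlap[/i0_neq_i1].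
    by [].
  by have [y] := uv i1;
    rewrite -halve1 => /esym/halve_overlap[_ /esym/i0_neq_i1].
case: b c uv => [] [] uv.
- by apply: IHv => x; have [y /halve_inj] := uv x; exists y.
- by have [y /halve_overlap[/emb_i0_neq1]] := uv i0.
- by have [y /esym/halve_overlap[_ /emb_i1_neq0]] := uv i1.
- by apply: IHv => x; have [y /halve_inj] := uv x; exists y.
Qed.

Lemma emb_eq u v : (forall x, emb u x = emb v x) -> u = v.
Proof.
move=> uv.
have /prefixP[p vE] : prefix u v.
  by apply: emb_sub_prefix => x; exists x; rewrite uv.
have /emb_sub_prefix : forall x, exists y, emb [::] x = emb p y.
  move=> x; exists x; apply: (@emb_inj u).
  by rewrite -[RHS]emb_cat -vE -uv.
by case: p vE => // ->; rewrite cats0.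
Qed.

(** Both embeddings being affine, so is [h] on the interval of address [u]. *)
Definition maps h u v := forall x, act h (emb u x) = emb v x.

Lemma maps1 u : maps 1%g u u. Proof. by []. Qed.

Lemma mapsM h k u v w : maps k u v -> maps h v w -> maps (h * k)%g u w.
Proof. by move=> kuv hvw x; rewrite actM kuv hvw. Qed.

Lemma mapsV h u v : maps h u v -> maps h^-1%g v u.
Proof. by move=> huv x; rewrite -huv actVK. Qed.

Lemma maps_cat h u v w : maps h u v -> maps h (u ++ w) (v ++ w).
Proof. by move=> huv x; rewrite !emb_cat. Qed.

Lemma maps_uniq h u v w : maps h u v -> maps h u w -> v = w.
Proof. by move=> huv huw; apply: emb_eq => x; rewrite -huv huw. Qed.

Lemma maps_fork h u v : (forall b,
  maps h (rcons u b) (rcons v b)) -> maps h u v.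
Proof.
by move=> huv x; have [b [y ->]] := halve_cover x; have := huv b y;
  rewrite -!cats1 !emb_cat.
Qed.

Lemma maps_nil h : maps h [::] [::] -> h = 1%g.
Proof. by move=> h1; apply: thompson_ext => x; rewrite (h1 x). Qed.

Section Num.
Local Open Scope ring_scope.

(** The left end of the interval of address [u] is [num u / 2 ^ size u]. *)
Fixpoint num u : nat := if u is b :: v then b * 2 ^ size v + num v else 0.

Lemma num_surj l m : (m < 2 ^ l)%N -> exists2 u, size u = l & num u = m.
Proof.
elim: l m => [|l IHl] m; first by rewrite expn0; case: m => // _; exists [::].
rewrite expnS => ml; have [m_lt|m_ge] := ltnP m (2 ^ l).
  by have [u ul um] := IHl _ m_lt; exists (false :: u); rewrite /= ?ul ?um.
have [|u ul um] := IHl (m - 2 ^ l)%N; first by lia.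
by exists (true :: u); rewrite /= ?ul // um; lia.
Qed.

Let pow2_neq0 n : (2 : R) ^+ n != 0.
Proof. by rewrite expf_neq0 // pnatr_eq0. Qed.

Lemma val_emb u x : val (emb u x) = ((num u)%:R + val x) / 2 ^+ size u.
Proof.
elim: u => [|b u IHu] /=; first by rewrite add0r divr1.
by rewrite val_halve IHu exprS natrD natrM natrX; field; rewrite pow2_neq0.
Qed.

Lemma dyadic_common_denominator (s : seq R) : (forall b, b \in s -> dyadic b) ->
  exists k : nat, forall b, b \in s -> exists m : int, b = m%:~R / 2 ^+ k.
Proof.
elim: s => [|a s IHs] ds; first by exists 0%N.
have [|k kP] := IHs; first by move=> b bs; apply: ds; rewrite inE bs orbT.
have [m [n ->]] := ds a (mem_head _ _).
exists (k + n)%N => b; rewrite inE => /orP[/eqP->|/kP[m' ->]].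
  exists (m * (2 : int) ^+ k).
  by rewrite intrM rmorphXn /= exprD; field; rewrite !pow2_neq0.
exists (m' * (2 : int) ^+ n).
by rewrite intrM rmorphXn /= exprD; field; rewrite !pow2_neq0.
Qed.

(** Cutting finely enough, the image of every dyadic cell is a dyadic interval:
    off the breakpoints [h] is [2 ^ s * r + c] with [c] dyadic, and it suffices
    that the images of the cells have length at most the inverse of the
    denominator of [c]. *)
Lemma affine_cells h u (s : int) (c : R) : dyadic c ->
    (forall x, val (act h (emb u x)) = 2 ^ s * val (emb u x) + c) ->
  exists j : nat, forall p, size p = j -> exists v, maps h (u ++ p) v.
Proof.
move=> [m [n cE]] haff; exists (n + `|s|)%N => p p_size.
have [l lE] : exists l : nat, l%:Z = (size u + size p)%:Z - s.
  by exists `|(size u + size p)%:Z - s|%N; lia.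
pose M := (num (u ++ p))%:Z + m * 2 ^+ (l - n).
have hE x : val (act h (emb (u ++ p) x)) = (M%:~R + val x) / 2 ^+ l.
  rewrite emb_cat haff -emb_cat val_emb size_cat cE /M.
  have -> : (2 : R) ^ s = 2 ^+ (size u + size p) / 2 ^+ l.
    have -> : s = (size u + size p)%:Z - l%:Z by lia.
    by rewrite expfzDr ?pnatr_eq0 // -invr_expz.
  have -> : (2 : R) ^+ l = 2 ^+ n * 2 ^+ (l - n) by rewrite -exprD subnKC //;
    lia.
  by rewrite intrD intrM rmorphXn /=; field; rewrite !pow2_neq0.
have M_ge0 : 0 <= M.
  have := unit_val_ge0 (act h (emb (u ++ p) i0)).
  by rewrite hE val_i0 addr0 pmulr_lge0 ?invr_gt0 ?exprn_gt0 // ler0z.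
have M_lt : M < 2 ^+ l.
  have := unit_val_le1 (act h (emb (u ++ p) i1)).
  rewrite hE val_i1 ler_pdivrMr ?exprn_gt0 // mul1r -lezD1 -(ler_int R).
  by rewrite intrD rmorphXn.
have M_lt_nat : (`|M| < 2 ^ l)%N.
  by rewrite -ltz_nat gez0_abs // -natz natrX.
have [v vl vM] := num_surj M_lt_nat.
exists v => x; apply: unit_interval_inj; rewrite hE val_emb vl vM.
by rewrite natr_absz ger0_norm.
Qed.

(** A tree of cells on each of which [h] is affine: the breakpoints of [h] lie
    on some dyadic grid, whose cells are cut further by [affine_cells]. *)
Lemma domain_tree h : exists s, forall p, p \in leaves s -> exists v,
  maps h p v.
Proof.
pose P u := exists s, forall p, p \in leaves s -> exists v, maps h (u ++ p) v.
have P_fork u : (forall b, P (rcons u b)) -> P u.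
  move=> Pu; have [[l lP] [r rP]] := (Pu false, Pu true).
  exists (Node l r) => p; rewrite mem_cat => /orP[] /mapP[q qs ->].
    by rewrite -cat_rcons; exact: lP.
  by rewrite -cat_rcons; exact: rP.
have P_level j u : (forall p, size p = j -> P (u ++ p)) -> P u.
  elim: j u => [|j IHj] u Pj; first by rewrite -[u]cats0; exact: Pj.
  apply: P_fork => b; apply: IHj => p pj.
  by rewrite cat_rcons; apply: Pj; rewrite /= pj.
suff Pnil : P [::] by exact: Pnil.
have [B [/finite_seqP[bs ->] B01 aff]] := (act_thompson h).2.
have [b /B01[]//|k kP] := @dyadic_common_denominator bs.
apply: (P_level k) => u uk; rewrite cat0s.
have emb_lt : val (emb u i0) < val (emb u i1).
  by rewrite !val_emb ltr_pM2r ?invr_gt0 ?exprn_gt0 // ltrD2l val_i0 val_i1.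
have [|s [c sc]] := aff _ _ (unit_val_ge0 _) emb_lt (unit_val_le1 _).
  move=> b /kP[m ->]; rewrite !val_emb uk val_i0 val_i1 addr0.
  rewrite !ltr_pM2r ?invr_gt0 ?exprn_gt0 // (_ : _ + 1 = ((num u)%:Z + 1)%:~R).
    by rewrite -[(num u)%:R]/((num u)%:~R) !ltr_int; lia.
  by rewrite intrD.
have haff x : val (act h (emb u x)) = 2 ^ s * val (emb u x) + c.
  apply: sc; rewrite !val_emb !ler_pM2r ?invr_gt0 ?exprn_gt0 // !lerD2l.
  by rewrite val_i0 val_i1 unit_val_ge0 unit_val_le1.
have [|j jP] := affine_cells _ haff; last first.
  apply: (P_level j) => p /jP[v hv]; exists Leaf => q; rewrite inE => /eqP->.
  by exists v; rewrite cats0.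
have du : dyadic (val (emb u i0)).
  by rewrite val_emb val_i0 addr0; exists (num u)%:Z, (size u).
have -> : c = val (act h (emb u i0)) + - (2 ^ s * val (emb u i0)).
  by rewrite haff; ring.
apply: dyadicD; first exact: (thompson_dyadic (act_thompson h) _).1 du.
by apply: dyadicN; exact: dyadicZ.
Qed.

End Num.

(** Adjacency of the consecutive intervals, expressed by equality of their
    ends. *)
Fixpoint chain x us y : Prop :=
  if us is u :: vs then emb u i0 = x /\ chain (emb u i1) vs y else x = y.

Lemma chain_cat x us vs y : chain x (us ++ vs) y <->
  exists2 z, chain x us z & chain z vs y.
Proof.
elim: us x => [|u us IHus] x /=.
  by split=> [xy|[z ->]] //; exists x.
split=> [[ux /IHus[z uz zy]]|[z [ux uz] zy]]; first by exists z.
by split=> //; apply/IHus; exists z.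
Qed.

Lemma chain_cons b x us y : chain x us y ->
  chain (halve b x) (map (cons b) us) (halve b y).
Proof. by elim: us x => [|u us IHus] x /= => [->//|[<- /IHus]]. Qed.

Lemma chain_leaves s : chain i0 (leaves s) i1.
Proof.
elim: s => //= l IHl r IHr; apply/chain_cat; exists (halve false i1).
  by rewrite -[X in chain X]halve0; exact: chain_cons.
by rewrite halve_mid -halve1; exact: chain_cons.
Qed.

Lemma chain_nonempty us x y : x <> i0 -> chain x us y -> [::] \notin us.
Proof.
elim: us x => // u us IHus x x0 /= [ux /(IHus _ (@emb_i1_neq0 u))].
rewrite inE negb_or => ->; rewrite andbT; apply: contra_notN x0 => /eqP u_nil.
by rewrite -ux -u_nil.
Qed.

Lemma chain_right vs x : chain (halve true x) vs i1 -> [::] \notin vs ->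
  exists2 ws, vs = map (cons true) ws & chain x ws i1.
Proof.
elim: vs x => [|[//|[] v] vs IHvs] x /=.
- by rewrite -{1}halve1 => /halve_inj ->; exists [::].
- move=> [/halve_inj vx /IHvs IH]; rewrite inE => /IH[ws -> ws1].
  by exists (v :: ws).
- by move=> [/halve_overlap[/emb_i0_neq1]].
Qed.

(** An interval of nonempty address lies in one half, so the adjacent intervals
    meet the midpoint at a common end. *)
Lemma chain_split vs x : x <> i1 -> chain (halve false x) vs i1 ->
  [::] \notin vs -> exists ws zs,
  [/\ vs = map (cons false) ws ++ map (cons true) zs, chain x ws i1
    & chain i0 zs i1].
Proof.
elim: vs x => [|[//|[] v] vs IHvs] x x1 /=.
- by rewrite -{1}halve1 => /halve_overlap[].
- by move=> [/esym/halve_overlap[]].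
- move=> [/halve_inj vx vs1]; rewrite inE => vs_nil.
  have [v1|v1] := pselect (emb v i1 = i1); last first.
    have [ws [zs [-> ws1 zs1]]] := IHvs _ v1 vs1 vs_nil.
    by exists (v :: ws), zs.
  rewrite v1 halve_mid in vs1; have [zs -> zs1] := chain_right vs1 vs_nil.
  by exists [:: v], zs.
Qed.

(** A subdivision of the unit interval into dyadic intervals is the set of
    leaves of a tree: no such interval other than the whole one contains the
    midpoint in its interior, so the subdivision splits there. *)
Lemma tree_of_chain vs : chain i0 vs i1 -> exists t, leaves t = vs.
Proof.
have [n sz] : exists n, forall v, v \in vs -> size v < n.
  by exists (\max_(v <- vs) size v).+1 => v vvs; rewrite ltnS leq_bigmax_seq.
elim: n vs sz => [|n IHn] [|v vs] sz; try by move=> /i0_neq_i1.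
  by have := sz v (mem_head _ _).
move=> [v0 vs1]; case: v => [|b v] in v0 vs1 sz *.
  case: vs vs1 sz => [_ _|w vs [/emb_i0_neq1]//].
  by exists Leaf.
have bv_nil : [::] \notin (b :: v) :: vs.
  by rewrite inE /=; apply: chain_nonempty vs1; exact: emb_i1_neq0.
have [||ws [zs [vsE ws1 zs1]]] := @chain_split ((b :: v) :: vs) i0 (@i0_neq_i1
  R).
- by split=> //; rewrite halve0.
- by [].
have [|l lE] := IHn ws _ ws1.
  by move=> u uw; apply: (sz (false :: u)); rewrite vsE mem_cat map_f.
have [|r rE] := IHn zs _ zs1.
  by move=> u uz; apply: (sz (true :: u)); rewrite vsE mem_cat orbC map_f.
by exists (Node l r); rewrite vsE /= lE rE.
Qed.

Fixpoint maps_seq h us vs : Prop :=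
  match us, vs with
  | u :: us, v :: vs => maps h u v /\ maps_seq h us vs
  | [::], [::] => True
  | _, _ => False
  end.

(** The images of the leaves of a domain tree of [h] are again adjacent and fill
    the unit interval, so they are the leaves of a tree. *)
Theorem tree_pair h : exists s t, maps_seq h (leaves s) (leaves t).
Proof.
have [s sP] := domain_tree h.
have [vs hvs] : exists vs, maps_seq h (leaves s) vs.
  elim: (leaves s) sP => [|u us IHus] usP; first by exists [::].
  have [v huv] := usP u (mem_head _ _).
  have [|vs hvs] := IHus; first by move=> p pus; apply: usP;
    rewrite inE pus orbT.
  by exists (v :: vs).
suff /tree_of_chain[t tE] : chain i0 vs i1 by exists s, t; rewrite tE.
have := chain_leaves s; rewrite -{2}(act_i0 h) -{2}(act_i1 h).
elim: (leaves s) vs i0 hvs => [|u us IHus] [|v vs] // x;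
  first by move=> _ /= ->.
by move=> [huv /IHus IH] /= [<- /IH]; rewrite !huv.
Qed.

End Addresses.

(** * Local copies of the group and rotations of trees *)

Section Extension.
Variable R : realType.
Local Notation F := (thompsonF R).
Local Notation I := (unit_interval R).
Implicit Types (x y : I) (h k phi psi : F) (u v w p q : seq bool).
Local Open Scope group_scope.

Lemma halves_unique h (phi : bool -> F) :
  (forall b x, act h (halve b x) = halve b (act (phi b) x)) -> h = halves phi.
Proof.
move=> hphi; apply: thompson_ext => x; have [b [y ->]] := halve_cover x.
by rewrite hphi act_halves.
Qed.

(** The copy of [phi] on the dyadic interval of address [u], trivial outside. *)
Fixpoint ext u phi : F :=
  if u is b :: v then halves (fun c => if c == b then ext v phi else 1) else
    phi.

Lemma ext_emb u phi x : act (ext u phi) (emb u x) = emb u (act phi x).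
Proof. by elim: u => //= b u IHu; rewrite act_halves eqxx IHu. Qed.

Lemma ext_cat u v phi : ext (u ++ v) phi = ext u (ext v phi).
Proof. by elim: u => //= b u ->. Qed.

Lemma ext_rcons u b phi : ext (rcons u b) phi = ext u (ext [:: b] phi).
Proof. by rewrite -cats1 ext_cat. Qed.

Lemma ext1 u : ext u 1 = 1.
Proof. by elim: u => //= b u ->; apply/esym/halves_unique => c x;
  rewrite if_same. Qed.

Lemma extM u phi psi : ext u (phi * psi) = ext u phi * ext u psi.
Proof.
elim: u => //= b u ->; apply/esym/halves_unique => c x.
by rewrite actM !act_halves; case: eqP.
Qed.

Lemma extV u phi : ext u phi^-1 = (ext u phi)^-1.
Proof. by apply/esym/mulg1_eq; rewrite -extM mulgV ext1. Qed.

Lemma ext_inj u : injective (ext u).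
Proof.
move=> phi psi e; apply: thompson_ext => x; apply: (@emb_inj _ u).
by rewrite -!ext_emb e.
Qed.

Lemma maps_ext u phi p q : maps phi p q -> maps (ext u phi) (u ++ p) (u ++ q).
Proof. by move=> phipq x; rewrite !emb_cat ext_emb phipq. Qed.

Lemma maps_ext_other b c u phi : c != b -> maps (ext (b :: u) phi) [:: c] [::
  c].
Proof. by move=> cb x; rewrite /= act_halves (negbTE cb). Qed.

Lemma ext_fix u phi x : (forall y, x <> emb u y) -> act (ext u phi) x = x.
Proof.
elim: u x => [|b u IHu] x xu; first by have := xu x.
have [c [y xE]] := halve_cover x; rewrite xE /= act_halves.
case: eqP => [cb|//]; rewrite IHu // => z yz.
by apply: (xu z); rewrite xE yz cb.
Qed.

(** Conjugation by an element that is affine on an interval transports the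
    copies of the group along it. *)
Lemma conj_ext h u v phi : maps h u v -> h * ext u phi * h^-1 = ext v phi.
Proof.
move=> huv; apply: thompson_ext => x.
have [[y ->]|xv] := pselect (exists y, x = emb v y).
  by rewrite !actM ext_emb (mapsV huv) ext_emb huv.
rewrite [RHS]ext_fix; last by move=> y xy; apply: xv; exists y.
rewrite !actM ext_fix ?actKV // => y xy; apply: xv; exists y.
by rewrite -huv -xy actKV.
Qed.

Lemma ext_of_maps b h : maps h [:: ~~ b] [:: ~~ b] -> exists phi,
  h = ext [:: b] phi.
Proof.
move=> hb.
have [f hE] : exists f, h = halves f.
  apply: halves_of_fix_mid; case: b hb => hb; first exact: hb.
  by rewrite halve_mid; exact: hb.
exists (f b); rewrite hE; apply: halves_unique => c x; rewrite act_halves.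
case: eqP => [-> //|/eqP cb]; congr halve; apply: (@halve_inj _ c).
by rewrite -act_halves -hE; have := hb x; rewrite -[~~ b](_ : c = _) //;
  case: b c cb {hb hE} => [] [].
Qed.

Lemma maps_seq1 us : maps_seq (1 : F) us us.
Proof. by elim: us. Qed.

Lemma maps_seqM h k us vs ws : maps_seq k us vs -> maps_seq h vs ws ->
  maps_seq (h * k) us ws.
Proof.
elim: us vs ws => [|u us IHus] [|v vs] [|w ws] //= [kuv kvs] [hvw hws].
by split; [exact: mapsM kuv hvw|exact: IHus kvs hws].
Qed.

Lemma maps_seqV h us vs : maps_seq h us vs -> maps_seq h^-1 vs us.
Proof.
by elim: us vs => [|u us IHus] [|v vs] //= [/mapsV huv /IHus].
Qed.

Lemma maps_seq_size h us vs : maps_seq h us vs -> size us = size vs.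
Proof. by elim: us vs => [|u us IHus] [|v vs] //= [_ /IHus ->]. Qed.

Lemma maps_seq_cat h us us' vs vs' : maps_seq h us us' -> maps_seq h vs vs' ->
  maps_seq h (us ++ vs) (us' ++ vs').
Proof.
by move=> + hvs; elim: us us' => [|u us IHus] [|u' us'] //= [hu /IHus].
Qed.

Lemma maps_seq_map h phi (e e' : seq bool -> seq bool) us vs :
  (forall u v, maps phi u v -> maps h (e u) (e' v)) ->
  maps_seq phi us vs -> maps_seq h (map e us) (map e' vs).
Proof.
move=> he; elim: us vs => [|u us IHus] [|v vs] //= [/he huv /IHus].
by split.
Qed.

Lemma maps_seq_map1 h (e e' : seq bool -> seq bool) us :
  (forall u, maps h (e u) (e' u)) -> maps_seq h (map e us) (map e' us).
Proof. by move=> he; elim: us => //= u us; split. Qed.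

Lemma maps_seq_fix h us : maps_seq h us us -> forall u, u \in us -> maps h u u.
Proof.
elim: us => // u us IHus [hu /IHus husP] v; rewrite inE => /orP[/eqP->//|].
exact: husP.
Qed.

(** The leaves of a tree cover the interval. *)
Lemma tree_pair_unique h k s vs :
  maps_seq h (leaves s) vs -> maps_seq k (leaves s) vs -> h = k.
Proof.
move=> hs /maps_seqV ks; have /maps_seq_fix fixP := maps_seqM hs ks.
suff kh : maps (k^-1 * h) [::] [::].
  by rewrite -[h](mulVKg k) (maps_nil kh) mulg1.
have {}fixP p : p \in leaves s -> maps (k^-1 * h) ([::] ++ p) ([::] ++ p).
  exact: fixP.
elim: s [::] fixP {hs ks} => [|l IHl r IHr] u fixP.
  by rewrite -[u]cats0; apply: fixP; rewrite inE.
apply: maps_fork => -[].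
  by apply: IHr => p pr; rewrite cat_rcons; apply: fixP;
    rewrite mem_cat orbC map_f.
by apply: IHl => p pl; rewrite cat_rcons; apply: fixP; rewrite mem_cat map_f.
Qed.

Lemma maps_rot_00 u : maps (rotation R) [:: false, false & u] (false :: u).
Proof. by move=> x; rewrite /= rot_00. Qed.

Lemma maps_rot_01 u : maps (rotation R) [:: false, true & u] [:: true,
  false & u].
Proof. by move=> x; rewrite /= rot_01. Qed.

Lemma maps_rot_1 u : maps (rotation R) (true :: u) [:: true, true & u].
Proof. by move=> x; rewrite /= rot_1. Qed.

Lemma maps_seq_rot a b c : maps_seq (rotation R)
  (leaves (Node (Node a b) c)) (leaves (Node a (Node b c))).
Proof.
rewrite /= !map_cat -!map_comp -catA.
do 2?[apply: maps_seq_cat]; apply: maps_seq_map1 => u /=.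
- exact: maps_rot_00.
- exact: maps_rot_01.
- exact: maps_rot_1.
Qed.

(** The rotation shifts the intervals of addresses ..., 001, 01, 10, 110, ...,
    the tiles of the interval. Tiling in the same way the tiles, the tiles of
    these and so on, [Full] marks the interval and its tiles of all levels, [Lft]
    and [Rgt] mark the remaining intervals, which are initial or final in some
    [Full] interval. *)
Inductive cell := Full | Lft | Rgt.

Definition step c (b : bool) : cell :=
  match c with
  | Full => if b then Rgt else Lft
  | Lft => if b then Full else Lft
  | Rgt => if b then Rgt else Full
  end.

Definition cell_of u : cell := foldl step Full u.

Fixpoint word c s : seq cell :=
  if s is Node l r then word (step c false) l ++ word (step c true) r
  else [:: c].

Lemma word_leaves c s : word c s = map (foldl step c) (leaves s).
Proof.
by elim: s c => //= l IHl r IHr c; rewrite IHl IHr map_cat -!map_comp.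
Qed.

Lemma word_Lft s : exists cs, word Lft s = Lft :: cs.
Proof.
elim: s => [|l [w lw] r _]; first by exists [::].
by exists (w ++ word Full r); rewrite /= lw.
Qed.

Lemma word_Full s : exists c cs, word Full s = c :: cs /\ c <> Rgt.
Proof.
case: s => [|l r]; first by exists Full, [::].
have [w lw] := word_Lft l.
by exists Lft, (w ++ word Rgt r); rewrite /= lw.
Qed.

Lemma leaves_gt0 s : 0 < size (leaves s).
Proof. by elim: s => //= l IHl r _; rewrite size_cat !size_map ltn_addr. Qed.

Section Similarity.
Variable D : subgroup F.
Implicit Types (s t l r : tree).

(** Asking for an element of the form [ext u phi] makes the relation local, so
    that relations on the two halves of an interval combine, see [sim_node]. *)
Definition sim u s t : Prop :=
  exists phi, (D : set F) (ext u phi) /\ maps_seq phi (leaves s) (leaves t).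

Lemma sim_refl u s : sim u s s.
Proof.
by exists 1; split; [rewrite ext1; exact: subgroup1|exact: maps_seq1].
Qed.

Lemma sim_sym u s t : sim u s t -> sim u t s.
Proof.
move=> [phi [Dphi phist]]; exists phi^-1; split; last exact: maps_seqV.
by rewrite extV; exact: subgroupV.
Qed.

Lemma sim_trans u s t r : sim u s t -> sim u t r -> sim u s r.
Proof.
move=> [phi [Dphi phist]] [psi [Dpsi psitr]]; exists (psi * phi).
by split; [rewrite extM; exact: subgroupM|exact: maps_seqM phist psitr].
Qed.

Lemma sim_size u s t : sim u s t -> size (leaves s) = size (leaves t).
Proof. by move=> [phi [_ /maps_seq_size]]. Qed.

Lemma sim_node u l l' r r' : sim (rcons u false) l l' -> sim (rcons u true) r
  r' ->
  sim u (Node l r) (Node l' r').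
Proof.
move=> [phi [Dphi phil]] [psi [Dpsi psir]].
pose f (b : bool) := if b then psi else phi.
exists (halves f); split.
  have -> : halves f = ext [:: false] phi * ext [:: true] psi.
    apply/esym/halves_unique => b x.
    by rewrite actM /= !act_halves; case: b.
  by rewrite extM -!ext_rcons; exact: subgroupM.
apply: maps_seq_cat.
  by apply: maps_seq_map phil => p q pq x; rewrite /= act_halves pq.
by apply: maps_seq_map psir => p q pq x; rewrite /= act_halves pq.
Qed.

Lemma sim_rot u a b c : (D : set F) (ext u (rotation R)) ->
  sim u (Node (Node a b) c) (Node a (Node b c)).
Proof. by move=> Du; exists (rotation R); split; last exact: maps_seq_rot. Qed.

(** Rotating at the root until its left subtree is a leaf. At a [Full] node this
    keeps the word, because the subtree that changes sides is a tile before and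
    after. *)
Lemma sim_comb u l r : (D : set F) (ext u (rotation R)) ->
  exists r', sim u (Node l r) (Node Leaf r') /\
    word Full (Node l r) = word Full (Node Leaf r').
Proof.
move=> Du; elim: l r => [|a IHa b _] r; first by exists r; split=> //;
  exact: sim_refl.
have [r' [abr wE]] := IHa (Node b r); exists r'; split.
  by apply: sim_trans abr; exact: sim_rot.
by rewrite -wE /= catA.
Qed.

(** When all rotations are allowed, trees with equally many leaves are both
    similar to the comb with that number of leaves. *)
Lemma sim_full u s t : (forall v, (D : set F) (ext (u ++ v) (rotation R))) ->
  size (leaves s) = size (leaves t) -> sim u s t.
Proof.
move: {2}(size (leaves s)) (leqnn (size (leaves s))) => n.
elim: n u s t => [|n IHn] u s t sn Du st; first by have := leaves_gt0 s; lia.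
case: s sn st => [|l r] sn st.
  case: t st => [_|l r] /=; first exact: sim_refl.
  by rewrite size_cat !size_map; have := leaves_gt0 l; have := leaves_gt0 r;
    lia.
case: t st => [|l' r'] st.
  move: st; rewrite /= size_cat !size_map.
  by have := leaves_gt0 l; have := leaves_gt0 r; lia.
have Du0 : (D : set F) (ext u (rotation R)) by rewrite -[u]cats0; exact: Du.
have [r1 [sr1 _]] := sim_comb l r Du0; have [r2 [sr2 _]] := sim_comb l' r' Du0.
apply: (sim_trans sr1); apply: sim_trans (sim_sym sr2).
apply: sim_node; first exact: sim_refl.
have e1 : size (leaves (Node l r)) = (size (leaves r1)).+1.
  by rewrite (sim_size sr1) /= size_map.
have e2 : size (leaves (Node l' r')) = (size (leaves r2)).+1.
  by rewrite (sim_size sr2) /= size_map.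
move: st sn; rewrite e1 e2 => -[st] sn.
by apply: IHn => // v; rewrite cat_rcons; exact: Du.
Qed.

(** The suffixes [cs] and [ds] turn unique readability of words into a statement
    that can be proved by induction. Trees at [Lft] nodes never have to be
    compared, since rotations make them leaves. *)
Lemma sim_word_aux u n s t (cs ds : seq cell) v :
  (forall w, cell_of w = Full -> (D : set F) (ext (u ++ w) (rotation R))) ->
  size (leaves s) <= n -> cell_of v <> Lft ->
  word (cell_of v) s ++ cs = word (cell_of v) t ++ ds ->
  cs = ds /\ sim (u ++ v) s t.
Proof.
move=> Du; elim: n s t cs ds v => [|n IHn] s t cs ds v sn.
  by have := leaves_gt0 s; lia.
case v_cell: (cell_of v) => //= _.
  case: s sn => [|l r] sn.
    case: t => [[->]|l r]; first by split=> //; exact: sim_refl.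
    by have [w lw] := word_Lft l; rewrite /= lw.
  case: t => [|l' r'].
    by have [w lw] := word_Lft l; rewrite /= lw.
  have [r1 [sr1 ->]] := sim_comb l r (Du _ v_cell).
  have [r2 [sr2 ->]] := sim_comb l' r' (Du _ v_cell).
  have vt : cell_of (rcons v true) = Rgt by rewrite /cell_of foldl_rcons
    -/(cell_of v) v_cell.
  have r1n : size (leaves r1) <= n.
    by move: sn; rewrite (sim_size sr1) /= size_map.
  move=> [e]; have [||cds r12] := IHn r1 r2 cs ds (rcons v true) r1n;
    rewrite ?vt //.
  split=> //; apply: (sim_trans sr1); apply: sim_trans (sim_sym sr2).
  by apply: sim_node; [exact: sim_refl|rewrite rcons_cat].
case: s sn => [|a r] sn.
  case: t => [[->]|a r]; first by split=> //; exact: sim_refl.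
  by have [c [w [aw cR]]] := word_Full a; rewrite /= aw => -[/esym].
case: t => [|a' r'].
  by have [c [w [aw cR]]] := word_Full a; rewrite /= aw => -[].
have vf : cell_of (rcons v false) = Full by rewrite /cell_of foldl_rcons
  -/(cell_of v) v_cell.
have vt : cell_of (rcons v true) = Rgt by rewrite /cell_of foldl_rcons
  -/(cell_of v) v_cell.
move: sn; rewrite /= size_cat !size_map => sn; rewrite -!catA => e.
have := leaves_gt0 a; have := leaves_gt0 r => r0 a0.
have [||| e' aa'] := IHn a a' (word Rgt r ++ cs) (word Rgt r' ++ ds) (rcons v
  false);
  rewrite ?vf //; first lia.
have [|||cds rr'] := IHn r r' cs ds (rcons v true); rewrite ?vt //; first lia.
by split=> //; apply: sim_node; rewrite rcons_cat.
Qed.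

(** The word of a tree is a well-parenthesised expression, with brackets [Lft],
    [Rgt] and atoms [Full], so it determines the words of the subtrees hanging
    off the left and right spines of its root; where on the spines they hang is
    undone by rotations at the root. Hence rotations at [Full] nodes connect any
    two trees with the same word. *)
Lemma sim_word u s t :
  (forall w, cell_of w = Full -> (D : set F) (ext (u ++ w) (rotation R))) ->
  word Full s = word Full t -> sim u s t.
Proof.
move=> Du st.
by have [||_] := @sim_word_aux u _ s t [::] [::] [::] Du (leqnn _);
  rewrite ?cats0.
Qed.

End Similarity.

(** The pentagon relation between the rotations at a node and at its two
    children. *)
Lemma rotation_pentagon : rotation R * rotation R =
  ext [:: true] (rotation R) * (rotation R * ext [:: false] (rotation R)).
Proof.
have e0 := @maps_ext [:: false] (rotation R).
have e1 := @maps_ext [:: true] (rotation R).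
pose s := Node (Node (Node Leaf Leaf) Leaf) Leaf.
pose t := Node Leaf (Node Leaf (Node Leaf Leaf)).
apply: (@tree_pair_unique _ _ s (leaves t)) => /=.
  split; first exact: mapsM (maps_rot_00 _) (maps_rot_00 _).
  split; first exact: mapsM (maps_rot_00 _) (maps_rot_01 _).
  split; first exact: mapsM (maps_rot_01 _) (maps_rot_1 _).
  by split; first exact: mapsM (maps_rot_1 _) (maps_rot_1 _).
have r1' w : maps (ext [:: false] (rotation R)) (true :: w) (true :: w).
  by apply: (@maps_cat _ _ [:: true] [:: true]); exact: maps_ext_other.
have r0' w : maps (ext [:: true] (rotation R)) (false :: w) (false :: w).
  by apply: (@maps_cat _ _ [:: false] [:: false]); exact: maps_ext_other.
split; first exact: mapsM (mapsM (e0 _ _ (maps_rot_00 [::])) (maps_rot_00 _))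
  (r0' _).
split; first exact: mapsM (mapsM (e0 _ _ (maps_rot_01 [::])) (maps_rot_01 _))
  (e1 _ _ (maps_rot_00 _)).
split; first exact: mapsM (mapsM (e0 _ _ (maps_rot_1 [::])) (maps_rot_01 _))
  (e1 _ _ (maps_rot_01 _)).
by split; first exact: mapsM (mapsM (r1' _) (maps_rot_1 _)) (e1 _ _ (maps_rot_1
  _)).
Qed.
End Extension.

Arguments ext : simpl never.

(** * A finitely generated subgroup maximal in the balanced elements *)

Section Subgroups.
Variable R : realType.
Local Notation F := (thompsonF R).
Implicit Types (h k phi psi : F) (u v w p q : seq bool).
Local Open Scope group_scope.

Local Notation rot := (rotation R).
Local Notation mid := [:: false; true].
Local Notation zeros m := (nseq m false).
Local Notation ones m := (nseq m true).

Lemma maps_rotV_0 u : maps rot^-1 (false :: u) [:: false, false & u].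
Proof. exact: mapsV (maps_rot_00 _). Qed.

Lemma maps_rotV_10 u : maps rot^-1 [:: true, false & u] [:: false, true & u].
Proof. exact: mapsV (maps_rot_01 _). Qed.

Lemma maps_rotV_11 u : maps rot^-1 [:: true, true & u] (true :: u).
Proof. exact: mapsV (maps_rot_1 _). Qed.

(** On the intervals of addresses 00, 0100, 0101, 011, 1 it is affine, with images
    000, 001, 01, 10, 11: it has slope 1/2 at both ends and expands a tile of
    [mid] onto [mid]. *)
Definition expander : F :=
  rot * (ext [:: false; false] rot^-1 * ext [:: false] rot^-1).

Local Notation f := expander.

Lemma maps_f_00 u : maps f [:: false, false & u] [:: false, false, false & u].
Proof.
apply: (mapsM (mapsM _ _) (maps_rot_00 _)).
  exact: (maps_ext [:: false]) (maps_rotV_0 _).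
exact: (maps_ext [:: false; false]) (maps_rotV_0 _).
Qed.

Lemma maps_f_mid : maps f (mid ++ mid) mid.
Proof.
apply: (mapsM (mapsM _ _) (maps_rot_00 _)).
  exact: (maps_ext [:: false]) (maps_rotV_10 _).
exact: (maps_ext [:: false; false]) (maps_rotV_11 _).
Qed.

Lemma maps_f_1 u : maps f (true :: u) [:: true, true & u].
Proof.
apply: (mapsM (mapsM _ _) (maps_rot_1 _));
  apply: (@maps_cat _ _ [:: true] [:: true]); exact: maps_ext_other.
Qed.

Lemma maps_fX_zeros n m : maps (f ^+ n) (zeros m.+2) (zeros (n + m).+2).
Proof.
elim: n => [|n IHn]; first by rewrite expg0; exact: maps1.
by rewrite expgS; apply: mapsM IHn _; exact: maps_f_00.
Qed.

Lemma maps_fX_ones n m : maps (f ^+ n) (ones m.+1) (ones (n + m).+1).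
Proof.
elim: n => [|n IHn]; first by rewrite expg0; exact: maps1.
by rewrite expgS; apply: mapsM IHn _; exact: maps_f_1.
Qed.

Lemma maps_nseq h b m n j : maps h (nseq m b) (nseq n b) ->
  maps h (nseq (m + j) b) (nseq (n + j) b).
Proof. by move=> hmn; rewrite !nseqD; exact: maps_cat. Qed.

(** Equality of the slopes at 0 and 1: both are [2 ^ (m - n)]. *)
Definition balanced_set : set F := [set h | exists m n,
  maps h (zeros m) (zeros n) /\ maps h (ones m) (ones n)].

Fact balanced_is_subgroup : is_subgroup balanced_set.
Proof.
split.
- by exists 0, 0; split; exact: maps1.
- move=> h k [m [n [h0 h1]]] [m' [n' [k0 k1]]].
  exists (m' + m), (n + n'); split.
    by apply: mapsM (maps_nseq m k0) _; rewrite addnC; exact: maps_nseq.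
  by apply: mapsM (maps_nseq m k1) _; rewrite addnC; exact: maps_nseq.
- by move=> h [m [n [h0 h1]]]; exists n, m; split; exact: mapsV.
Qed.

Definition balanced : subgroup F := Subgroup balanced_is_subgroup.

(** Near the ends [h] acts like a power of [f], and multiplying by powers of [f]
    on both sides shrinks the region where it does not into [mid]. *)
Lemma balanced_shrink h : (balanced : set F) h ->
  exists m n phi, (f ^+ n)^-1 * h * f ^+ m = ext mid phi.
Proof.
move=> [m [n [h0 h1]]]; exists m, n; set k := _ * _ * _.
have k00 : maps k (zeros 2) (zeros 2).
  apply: mapsM (maps_fX_zeros m 0) _; apply: (@mapsM _ _ _ _ (zeros (n + 2))).
    by rewrite addn0 -addn2; exact: maps_nseq.
  by apply: mapsV; have := maps_fX_zeros n 0; rewrite addn0 addn2.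
have k1 : maps k [:: true] [:: true].
  apply: mapsM (maps_fX_ones m 0) _; apply: (@mapsM _ _ _ _ (ones (n + 1))).
    by rewrite addn0 -addn1; exact: maps_nseq.
  by apply: mapsV; have := maps_fX_ones n 0; rewrite addn0 addn1.
have [psi kE] := @ext_of_maps _ false k k1.
have [|phi psiE] := @ext_of_maps _ true psi.
  move=> x; apply: (@halve_inj _ false).
  by rewrite -[LHS](ext_emb [:: false]) -kE; exact: k00.
by exists phi; rewrite kE psiE.
Qed.

Definition base_of (c : cell) : seq bool :=
  match c with Full => [::] | Lft => [:: false] | Rgt => [:: true] end.

(** The conjugates of the second generator by powers of [f] have increasing
    supports, and each of them moves the support of the preceding one through a
    tiling of its own support. *)
Definition brin_navas : subgroup F := generated_subgroup [set f; ext mid rot].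

Local Notation B := brin_navas.

Lemma brin_navas_f : (B : set F) f.
Proof. by apply: sub_generated; left. Qed.

Lemma brin_navas_g : (B : set F) (ext mid rot).
Proof. by apply: sub_generated; right. Qed.

(** Up to the action of [B], a dyadic subinterval of [mid] is determined by its
    label. *)
Lemma brin_navas_transport v :
  exists2 b, (B : set F) b & maps b (mid ++ base_of (cell_of v)) (mid ++ v).
Proof.
have Bf := brin_navas_f; have Bg := brin_navas_g.
elim/last_ind: v => [|v b [d Bd dv]]; first by exists 1;
  [exact: subgroup1|exact: maps1].
have dvb := maps_cat [:: b] dv; rewrite -[_ ++ [:: b]]catA cats1 in dvb.
rewrite -catA cats1 in dvb.
rewrite /cell_of foldl_rcons -/(cell_of v).
case: (cell_of v) b dvb => -[] dvb; try by exists d.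
- exists (d * f^-1); first by apply: subgroupM => //; exact: subgroupV.
  exact: mapsM (mapsV maps_f_mid) dvb.
- exists (d * (ext mid rot)^-1).
    by apply: subgroupM => //; exact: subgroupV.
  exact: mapsM (mapsV (maps_ext mid (maps_rot_00 [::]))) dvb.
- exists (d * ext mid rot); first exact: subgroupM.
  exact: mapsM (maps_ext mid (maps_rot_1 [::])) dvb.
- exists (d * (ext mid rot * f^-1)).
    by do 2?[apply: subgroupM => //]; exact: subgroupV.
  apply: mapsM dvb; apply: mapsM (mapsV maps_f_mid) _.
  exact: (maps_ext mid (maps_rot_01 [::])).
Qed.

Lemma brin_navas_rot v : cell_of v = Full -> (B : set F) (ext (mid ++ v) rot).
Proof.
move=> v_full; have [b Bb] := brin_navas_transport v;
  rewrite v_full cats0 => bv.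
rewrite -(conj_ext _ bv); apply: subgroupM; last exact: subgroupV.
by apply: subgroupM => //; exact: brin_navas_g.
Qed.

Lemma maps_ext_mid_00 phi u :
  maps (ext mid phi) [:: false, false & u] [:: false, false & u].
Proof.
apply: (@maps_cat _ _ [:: false; false] [:: false; false]).
rewrite (ext_cat [:: false] [:: true]).
by apply: (@maps_ext _ [:: false] _ [:: false] [:: false]);
  exact: maps_ext_other.
Qed.

Lemma balanced_ext_mid phi : (balanced : set F) (ext mid phi).
Proof.
exists 2, 2; split; first exact: maps_ext_mid_00.
by apply: (@maps_cat _ _ [:: true] [:: true]); exact: maps_ext_other.
Qed.

Lemma brin_navas_sub_balanced : B `<=` balanced.
Proof.
apply: generated_sub => _ [->|->]; last exact: balanced_ext_mid.
by exists 2, 3; split; [exact: maps_f_00|exact: maps_f_1].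
Qed.

(** The rotations generate the copy of the whole group on [mid], by [sim_full]. *)
Lemma sub_full_rot (M : subgroup F) : (M : set F) f ->
  (forall v, (M : set F) (ext (mid ++ v) rot)) -> balanced `<=` M.
Proof.
move=> Mf Mrot h /balanced_shrink[m [n [phi hphi]]].
have -> : h = f ^+ n * ext mid phi * (f ^+ m)^-1.
  by rewrite -hphi !mulgA mulgV mul1g mulgK.
apply: subgroupM; last by apply: subgroupV; exact: subgroupX.
apply: subgroupM; first exact: subgroupX.
have [s [t st]] := tree_pair phi.
have [psi [Mpsi psi_st]] := sim_full Mrot (maps_seq_size st).
by rewrite (tree_pair_unique st psi_st).
Qed.

Lemma maps_seq_mismatch phi us vs : maps_seq phi us vs ->
  map cell_of us <> map cell_of vs ->
  exists p q, maps phi p q /\ cell_of p <> cell_of q.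
Proof.
elim: us vs => [|u us IHus] [|v vs] //= [uv /IHus usvs] ne.
have [e|] := pselect (cell_of u = cell_of v); last by exists u, v.
by apply: usvs => e'; apply: ne; rewrite e e'.
Qed.

(** Unless one of the labels is [Full] already, they are [Lft] and [Rgt]; the
    right half of a [Lft] interval is [Full], that of a [Rgt] interval is not. *)
Lemma mismatch_full (M : subgroup F) h p q : (M : set F) h ->
  maps h (mid ++ p) (mid ++ q) -> cell_of p <> cell_of q ->
  exists k v w, [/\ (M : set F) k, maps k (mid ++ v) (mid ++ w),
    cell_of v = Full & cell_of w <> Full].
Proof.
move=> Mh hpq; have MVh := subgroupV Mh; have hqp := mapsV hpq.
have next k v w : maps k (mid ++ v) (mid ++ w) ->
    maps k (mid ++ rcons v true) (mid ++ rcons w true).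
  by rewrite -!cats1 !catA => /maps_cat.
have nextE v : cell_of (rcons v true) = step (cell_of v) true.
  by rewrite /cell_of foldl_rcons.
case pc: (cell_of p); case qc: (cell_of q) => // _.
- by exists h, p, q; rewrite qc.
- by exists h, p, q; rewrite qc.
- by exists h^-1, q, p; rewrite pc.
- by exists h, (rcons p true), (rcons q true); rewrite !nextE pc qc;
    split=> //; exact: next.
- by exists h^-1, q, p; rewrite pc.
- by exists h^-1, (rcons q true), (rcons p true); rewrite !nextE pc qc;
    split=> //; exact: next.
Qed.

(** Conjugating the rotation of a [Full] interval by [h] gives the rotation of a
    [Lft] or [Rgt] interval, which [B] moves to one of the halves of [mid]. The
    pentagon relation yields the other half, and [B] transports these rotations
    to the intervals of all labels. *)
Lemma mismatch_all_rot (M : subgroup F) h p q : B `<=` M -> (M : set F) h ->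
  maps h (mid ++ p) (mid ++ q) -> cell_of p <> cell_of q ->
  forall v, (M : set F) (ext (mid ++ v) rot).
Proof.
move=> BM Mh hpq pq_cell.
have Mconj k u v : (M : set F) k -> maps k u v ->
    (M : set F) (ext u rot) -> (M : set F) (ext v rot).
  move=> Mk kuv Mu; rewrite -(conj_ext _ kuv).
  by do 2?[apply: subgroupM => //]; exact: subgroupV.
have [k [v [w [Mk kvw v_full w_full]]]] := mismatch_full Mh hpq pq_cell.
have Mw : (M : set F) (ext (mid ++ w) rot).
  by apply: Mconj kvw _ => //; apply: BM; exact: brin_navas_rot.
have Mbase : (M : set F) (ext (mid ++ base_of (cell_of w)) rot).
  have [b /BM Mb bw] := brin_navas_transport w.
  by apply: Mconj (mapsV bw) Mw; exact: subgroupV.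
have M_mid : (M : set F) (ext mid rot) by apply: BM; exact: brin_navas_g.
have pentagon : ext mid rot * ext mid rot =
    ext (mid ++ [:: true]) rot * (ext mid rot * ext (mid ++ [:: false]) rot).
  by rewrite !ext_cat -!extM rotation_pentagon.
have M01 : (M : set F) (ext (mid ++ [:: false]) rot) <->
    (M : set F) (ext (mid ++ [:: true]) rot).
  have := subgroupM M_mid M_mid; rewrite pentagon => MM.
  split=> [M0|M1].
    by apply/(subgroupMr _ (x := ext mid rot * ext (mid ++ [:: false]) rot)) =>
      //; exact: subgroupM.
  by move: MM => /(subgroupMl _ M1)/(subgroupMl _ M_mid).
have [M0 M1] : (M : set F) (ext (mid ++ [:: false]) rot) /\
    (M : set F) (ext (mid ++ [:: true]) rot).
  by case: (cell_of w) w_full Mbase => // _ Mb; split=> //; apply/M01.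
move=> u; have [b /BM Mb bu] := brin_navas_transport u.
by apply: (Mconj _ _ _ Mb bu); case: (cell_of u).
Qed.

Lemma brin_navas_maximal (M : subgroup F) : B `<=` M -> M `<=` balanced ->
  (exists2 h, (M : set F) h & ~ (B : set F) h) -> balanced `<=` M.
Proof.
move=> BM MK [h Mh Bh]; have Mf := BM _ brin_navas_f.
have [m [n [phi hphi]]] := balanced_shrink (MK _ Mh).
have conj_in (D : subgroup F) : (D : set F) f ->
    (D : set F) (ext mid phi) <-> (D : set F) h.
  move=> Df; have DfX j := subgroupX j Df; rewrite -hphi.
  split=> [|Dh]; last by do 2?[apply: subgroupM => //]; exact: subgroupV.
  by move=> /(subgroupMr _ (DfX m))/(subgroupMl _ (subgroupV (DfX n))).
have Mphi : (M : set F) (ext mid phi) by apply/conj_in.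
apply: sub_full_rot => //; have [s [t st]] := tree_pair phi.
have [w_eq|w_ne] := pselect (word Full s = word Full t).
  have [psi [Bpsi psi_st]] := sim_word brin_navas_rot w_eq.
  case: Bh; apply/conj_in; first exact: brin_navas_f.
  by rewrite (tree_pair_unique st psi_st).
rewrite !word_leaves in w_ne.
have [p [q [phipq pq]]] := maps_seq_mismatch st w_ne.
exact: mismatch_all_rot BM Mphi (maps_ext mid phipq) pq.
Qed.

End Subgroups.

(** * Elementary amenability of the maximal subgroup *)

Section Tower.
Variable R : realType.
Local Notation F := (thompsonF R).
Implicit Types (h phi psi : F) (u v w p q : seq bool) (i s : int).
Local Open Scope group_scope.

Local Notation rot := (rotation R).
Local Notation f := (expander R).
Local Notation mid := [:: false; true].

(** The tiles of the unit interval, from left to right; tile 0 is [[1/2, 3/4]]. *)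
Definition tile i : seq bool :=
  match i with
  | Posz n => rcons (nseq n.+1 true) false
  | Negz n => rcons (nseq n.+1 false) true
  end.

(** [maps h u v] is the case [psi = 1]. *)
Definition acts_as h u v psi :=
  forall x, act h (emb u x) = emb v (act psi x).

Lemma acts_as1 u : acts_as (1 : F) u u 1.
Proof. by []. Qed.

Lemma acts_asM h k u v w phi psi : acts_as k u v psi -> acts_as h v w phi ->
  acts_as (h * k) u w (phi * psi).
Proof. by move=> kuv hvw x; rewrite actM kuv hvw. Qed.

Lemma acts_asV h u v psi : acts_as h u v psi -> acts_as h^-1 v u psi^-1.
Proof.
by move=> huv x; rewrite -{1}(actKV psi x) -huv actVK.
Qed.

Lemma maps_tile_rot i : maps rot (tile i) (tile (i + 1)%R).
Proof.
case: i => [n|[|n]].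
- have -> : (Posz n + 1)%R = Posz n.+1 by lia.
  exact: maps_rot_1.
- exact: maps_rot_01.
- have -> : (Negz n.+1 + 1)%R = Negz n by lia.
  exact: maps_rot_00.
Qed.

Lemma leaves_first (s : tree) : exists m us, leaves s = nseq m false :: us.
Proof.
elim: s => [|l [m [us lE]] r _]; first by exists 0, [::].
by exists m.+1; rewrite /= lE /=; eexists.
Qed.

Lemma leaves_last (s : tree) : exists m us, leaves s = rcons us (nseq m true).
Proof.
elim: s => [|l _ r [m [us rE]]]; first by exists 0, [::].
by exists m.+1; rewrite /= rE map_rcons -rcons_cat; eexists.
Qed.

Lemma maps_seq_last h us u vs v :
  maps_seq h (rcons us u) (rcons vs v) -> maps h u v.
Proof.
elim: us vs => [|u' us IHus] [|v' vs] /=; try by case.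
- by move=> [_]; case: vs.
- by move=> [_]; case: us {IHus}.
- by move=> [_ /IHus].
Qed.

Lemma maps_ends h b : exists m n, maps h (nseq m b) (nseq n b).
Proof.
have [s [t]] := tree_pair h; case: b.
  have [m [us ->]] := leaves_last s; have [n [vs ->]] := leaves_last t.
  by move/maps_seq_last; exists m, n.
have [m [us ->]] := leaves_first s; have [n [vs ->]] := leaves_first t.
by move=> [hmn _]; exists m, n.
Qed.

(** The tiles accumulate at the ends only; an element of the group is linear
    there, and it is trivial there as soon as it fixes one more tile. *)
Lemma tiles_fixed phi : (forall i, maps phi (tile i) (tile i)) -> phi = 1.
Proof.
move=> phi_tile; apply: maps_nil.
have fixed b m : maps phi (nseq m.+1 b ++ [:: ~~ b]) (nseq m.+1 b ++ [:: ~~ b]).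
  by rewrite cats1; case: b;
    [exact: (phi_tile (Posz m))|exact: (phi_tile (Negz m))].
suff fixed1 b : maps phi [:: b] [:: b] by apply: maps_fork => b; exact: fixed1.
have [m [n /(maps_nseq 1) hmn]] := maps_ends phi b; rewrite !addn1 in hmn.
have /(congr1 size) := maps_uniq (fixed b m) (maps_cat [:: ~~ b] hmn).
rewrite !size_cat !size_nseq !addn1 => -[mn]; rewrite -mn in hmn.
elim: m hmn {mn} => // m IHm hm; apply: IHm; apply: maps_fork => c;
  rewrite -cats1.
have [->|cb] := eqVneq c b; first by rewrite -[[:: b]]/(nseq 1 b) -nseqD addn1.
by rewrite (_ : c = ~~ b) //; case: (c) (b) cb => -[].
Qed.

(** For [j = 0] this is the trace on the group of the iterated unrestricted
    wreath product of [k] infinite cyclic groups, each acting on a tiling by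
    shifts; in general [j] is the number of levels at which all tiles are
    fixed. *)
Fixpoint tower k j : set F :=
  if k is k'.+1 then [set phi | exists s (psi : int -> F), (0 < j -> s = 0%R) /\
    forall i, tower k' j.-1 (psi i) /\ acts_as phi (tile i) (tile (i + s)%R)
      (psi i)]
  else [set 1].

Fact tower_is_subgroup k j : is_subgroup (tower k j).
Proof.
elim: k j => [|k IHk] j.
  by split=> [|x y -> ->|x ->] /=; rewrite ?mulg1 ?invg1.
split.
- exists 0%R, (fun=> 1); split=> // i; rewrite addr0; split;
    last exact: acts_as1.
  by case: (IHk j.-1).
- move=> x y [s [psi [sj xpsi]]] [s' [psi' [s'j ypsi']]].
  exists (s' + s)%R, (fun i => psi (i + s')%R * psi' i); split.
    by move=> j0; rewrite sj // s'j // addr0.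
  move=> i; have [psi'i yi] := ypsi' i; have [psii xi] := xpsi (i + s')%R;
    split.
    by case: (IHk j.-1) => _ + _; apply.
  by rewrite addrA; exact: acts_asM yi xi.
- move=> x [s [psi [sj xpsi]]].
  exists (- s)%R, (fun i => (psi (i - s)%R)^-1); split.
    by move=> j0; rewrite sj // oppr0.
  move=> i; have [psii xi] := xpsi (i - s)%R; split.
    by case: (IHk j.-1) => _ _; apply.
  by rewrite subrK in xi; exact: acts_asV.
Qed.

Definition tower_group k j : subgroup F := Subgroup (tower_is_subgroup k j).

Lemma tower_trivial k phi : tower k k phi -> phi = 1.
Proof.
elim: k phi => // k IHk phi [s [psi [s0 phipsi]]]; apply: tiles_fixed => i x.
have [/= /IHk psi1] := phipsi i.
by rewrite s0 // addr0 psi1; apply.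
Qed.

Lemma tower_sub k j : tower k j.+1 `<=` tower k j.
Proof.
elim: k j => [|k IHk] j phi //= [s [psi [s0 phipsi]]].
exists s, psi; split=> [_|i]; first exact: s0.
have [psii phii] := phipsi i; split=> //.
by case: j psii {s0 phipsi} => // j; exact: IHk.
Qed.

(** At the first level where [x] and [y] need not fix the tiles, they shift them,
    and shifts commute. *)
Lemma tower_commutator k j x y : j < k -> tower k j x -> tower k j y ->
  tower k j.+1 [~ x, y].
Proof.
elim: k j x y => // k IHk j x y jk.
move=> [s [psi [s0 xpsi]]] [s' [psi' [s'0 ypsi']]].
(* [y] moves tile [i] to tile [i + s'], then [x] moves it to [i + s' + s], and
   the inverses bring it back through [i + s]. *)
exists 0%R, (fun i => (psi i)^-1 * ((psi' (i + s)%R)^-1 * (psi (i + s')%R *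
  psi' i))).
split=> // i; split=> /=; last first.
  rewrite addr0; apply: acts_asM (acts_asV (xpsi i).2).
  apply: acts_asM (acts_asV (ypsi' (i + s)%R).2).
  rewrite -addrA [(s + s')%R]addrC addrA.
  by apply: acts_asM (xpsi _).2; exact: (ypsi' i).2.
case: j jk s0 s'0 xpsi ypsi' => [|j] jk s0 s'0 xpsi ypsi'.
  have [_ towerM towerV] := tower_is_subgroup k 0.
  exact: (towerM _ _ (towerV _ (xpsi i).1) (towerM _ _ (towerV _ (ypsi' _).1)
    (towerM _ _ (xpsi _).1 (ypsi' i).1))).
by rewrite s0 // s'0 // addr0; apply: IHk => //;
  [exact: (xpsi i).1|exact: (ypsi' i).1].
Qed.

(** The groups [tower k j], for [j] from [k] down to 0, form a series with abelian
    quotients, starting at the trivial group. *)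
Lemma ea_tower k j : j <= k -> elementary_amenable (tower_group k j).
Proof.
move=> /subnKC <-; move: (k - j)%N => n.
elim: n j => [|n IHn] j.
  by rewrite addn0; apply: ea_trivial => phi; exact: tower_trivial.
apply: (@ea_abelian_extension _ _ (tower_group (j + n.+1) j.+1)).
- exact: tower_sub.
- by move=> x y; apply: tower_commutator; rewrite addnS ltnS leq_addr.
- by rewrite addnS -addSn; exact: IHn.
Qed.

Lemma tower_rot : tower 1 0 rot.
Proof.
exists 1%R, (fun=> 1); split=> // i; split=> // x.
exact: maps_tile_rot.
Qed.

Lemma tower_leS k : tower k 0 `<=` tower k.+1 0.
Proof.
elim: k => [_ ->|k IHk phi [s [psi [s0 phipsi]]]].
  by have [] := tower_is_subgroup 1 0.
exists s, psi; split=> // i; have [psii phii] := phipsi i.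
by split=> //; exact: IHk.
Qed.

Lemma maps_ext_mid phi i : i <> Negz 0 -> maps (ext mid phi) (tile i) (tile i).
Proof.
case: i => [n _|[//|n] _].
  by apply: (@maps_cat _ _ [:: true] [:: true]); exact: maps_ext_other.
exact: maps_ext_mid_00.
Qed.

Lemma tower_ext k phi : tower k 0 phi -> tower k.+1 0 (ext mid phi).
Proof.
move=> phik; exists 0%R, (fun i => if i == Negz 0 then phi else 1).
split=> // i; rewrite addr0; case: eqP => [->|ni]; split=> //.
- by move=> x; rewrite (ext_emb mid).
- by have [] := tower_is_subgroup k 0.
- exact: maps_ext_mid.
Qed.

Lemma prefix_tile i : prefix (tile i) [:: true; false] -> i = 0%R.
Proof. by case: i => [[|[|n]]|[|n]]. Qed.

Lemma tower_ext_inv k phi : tower k 0 (ext mid phi) -> exists j, tower j 0 phi.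
Proof.
case: k => [|k] => [phi1|[s [psi [_ phipsi]]]].
  by exists 0; apply: (@ext_inj _ mid); rewrite ext1; exact: phi1.
have s0 : s = 0%R.
  have [_ phi0] := phipsi 0%R; rewrite add0r in phi0.
  apply: prefix_tile; apply: emb_sub_prefix => x; exists (act (psi 0%R) x).
  by rewrite -phi0 (@maps_ext_mid phi 0%R).
have [psik phiN1] := phipsi (Negz 0); exists k.
suff -> : phi = psi (Negz 0) by [].
apply: thompson_ext => x; apply: (@emb_inj _ mid).
by rewrite -(ext_emb mid) phiN1 s0 addr0.
Qed.

(** This element fixes tile 0, so it would have to fix all tiles, but it moves the
    tile of address 001. *)
Lemma not_tower k : ~ tower k 0 (ext [:: false] rot).
Proof.
case: k => [|k] => [rot1|[s [psi [_ rotpsi]]]].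
  have rot_00 : maps (ext [:: false] rot) [:: false; false; false] [:: false;
    false].
    exact: (@maps_ext _ [:: false] _ [:: false;
      false] [:: false]) (maps_rot_00 [::]).
  by move: rot_00; rewrite [ext _ _]rot1 => /(maps_uniq (maps1 _)).
have s0 : s = 0%R.
  have [_ rot0] := rotpsi 0%R; rewrite add0r in rot0.
  apply: prefix_tile; apply: emb_sub_prefix => x; exists (act (psi 0%R) x).
  rewrite -rot0; apply/esym; move: x;
    apply: (@maps_cat _ _ [:: true] [:: true]).
  exact: maps_ext_other.
have [_ rotN2] := rotpsi (Negz 1); rewrite s0 addr0 in rotN2.
suff : prefix (tile (Negz 1)) [:: false; true; false] by [].
apply: emb_sub_prefix => x; exists (act (psi (Negz 1)) x).
rewrite -rotN2; apply/esym; move: x.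
exact: (@maps_ext _ [:: false] _ [:: false; true] [:: true;
  false]) (maps_rot_01 [::]).
Qed.

(** The index counts the factors [f]. The representation is not unique, see
    [graded_shift]. *)
Definition graded i : set F := [set h | exists m n k phi,
  [/\ (Posz n - Posz m)%R = i, tower k 0 phi &
    h = f ^+ n * ext mid phi * (f ^+ m)^-1]].

Lemma f_conj phi : ext mid phi = f * ext mid (ext mid phi) * f^-1.
Proof. by rewrite -ext_cat (conj_ext _ (@maps_f_mid R)). Qed.

(** Since [f^-1] maps [mid] onto a tile of [mid], conjugation by [f^-1] turns the
    copy of [phi] on [mid] into the copy on a tile, which has one more level. *)
Lemma graded_shift (j m n k : nat) phi : tower k 0 phi -> exists psi,
  tower (k + j) 0 psi /\
  f ^+ n * ext mid phi * (f ^+ m)^-1 =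
    f ^+ (n + j) * ext mid psi * (f ^+ (m + j))^-1.
Proof.
elim: j => [|j IHj] phik; first by exists phi; rewrite !addn0.
have [psi [psik ->]] := IHj phik; exists (ext mid psi); split.
  by rewrite addnS; exact: tower_ext.
rewrite {1}f_conj !addnS; move: (expander R) => e.
by rewrite !expgSr invgM !mulgA.
Qed.

Lemma tower_le k l : k <= l -> tower k 0 `<=` tower l 0.
Proof.
move=> /subnKC <-; elim: (l - k)%N => [|n IHn]; first by rewrite addn0.
by rewrite addnS; exact: subset_trans IHn (@tower_leS _).
Qed.

Lemma gradedM i s x y : graded i x -> graded s y -> graded (i + s)%R (x * y).
Proof.
move=> [m [n [k [phi [<- phik ->]]]]] [m' [n' [k' [psi [<- psik ->]]]]].
(* The two inner powers of [f] get the same exponent [m + n']. *)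
have [phi' [phik' ->]] := graded_shift n' m n phik.
have [psi' [psik' ->]] := graded_shift m m' n' psik.
exists (m' + m), (n + n'), (maxn (k + n') (k' + m)), (phi' * psi'); split.
- by rewrite !PoszD; lia.
- have [_ towerM _] := tower_is_subgroup (maxn (k + n') (k' + m)) 0.
  by apply: towerM; [apply: tower_le phik'|apply: tower_le psik']; lia.
- by rewrite extM [m + n']addnC -!mulgA mulKg.
Qed.

Lemma gradedV i x : graded i x -> graded (- i)%R x^-1.
Proof.
move=> [m [n [k [phi [<- phik ->]]]]]; exists n, m, k, phi^-1; split.
- by lia.
- by have [_ _ towerV] := tower_is_subgroup k 0; exact: towerV.
- by rewrite !invgM invgK extV !mulgA.
Qed.

Lemma graded1 : graded 0%R 1.
Proof. by exists 0, 0, 0, 1; split=> //; rewrite expg0 ext1 invg1 !mulg1. Qed.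

Fact graded0_is_subgroup : is_subgroup (graded 0%R).
Proof.
split; first exact: graded1.
  by move=> x y x0 y0; rewrite -[0%R](addr0 0%R); exact: gradedM.
by move=> x x0; rewrite -[0%R]oppr0; exact: gradedV.
Qed.

Fact graded_is_subgroup : is_subgroup (\bigcup_i graded i).
Proof.
split; first by exists 0%R => //; exact: graded1.
  by move=> x y [i _ xi] [s _ ys]; exists (i + s)%R => //; exact: gradedM.
by move=> x [i _ xi]; exists (- i)%R => //; exact: gradedV.
Qed.

Fact tower_conj_is_subgroup (n k : nat) : is_subgroup
  ((fun phi => f ^+ n * ext mid phi * (f ^+ n)^-1) @` tower k 0).
Proof.
have [tower1 towerM towerV] := tower_is_subgroup k 0; split.
- by exists 1 => //; rewrite ext1 mulg1 mulgV.
- move=> _ _ [phi phik <-] [psi psik <-]; exists (phi * psi);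
    first exact: towerM.
  by rewrite extM -!mulgA mulKg.
- move=> _ [phi phik <-]; exists phi^-1; first exact: towerV.
  by rewrite extV !invgM invgK mulgA.
Qed.

(** The elements of index 0 contain all commutators, and they form the directed
    union of conjugates of copies of the groups [tower k 0]. *)
Lemma ea_graded : elementary_amenable (Subgroup graded_is_subgroup).
Proof.
apply: (@ea_abelian_extension _ _ (Subgroup graded0_is_subgroup)).
- by move=> x x0; exists 0%R.
- move=> x y [i _ xi] [s _ ys].
  suff : graded (- i + (- s + (i + s)))%R [~ x, y].
    by have -> : (- i + (- s + (i + s)))%R = 0%R by lia.
  exact: gradedM (gradedV xi) (gradedM (gradedV ys) (gradedM xi ys)).
apply: (@ea_directed_family _ _ (nat * nat)
  (fun nk => Subgroup (tower_conj_is_subgroup nk.1 nk.2)) (0, 0)).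
- move=> [n k] [n' k']; exists (n + n', maxn (k + n') (k' + n)).
  split=> _ [phi phik <-] /=.
    have [psi [psik ->]] := graded_shift n' n n phik.
    by exists psi => //; apply: tower_le psik; rewrite /= leq_max leqnn.
  have [psi [psik ->]] := graded_shift n n' n' phik.
  by exists psi; rewrite /= 1?[n' + n]addnC //; apply: tower_le psik;
    rewrite leq_max leqnn orbT.
- apply/seteqP; split=> [x [m [n [k [phi [mn phik ->]]]]]|x [[n k] _ [phi phik
    <-]]].
    have -> : m = n by lia.
    by exists (n, k) => //; exists phi.
  by exists n, n, k, phi; split=> //; lia.
- move=> [n k]; apply: (ea_image (phi := fun phi => f ^+ n * ext mid phi * (f
    ^+ n)^-1)
    _ _ _ (ea_tower (leq0n k))).
  + move=> phi psi _ _; by rewrite /= extM -!mulgA mulKg.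
  + by move=> phi psi _ _ /mulIg/mulgI/ext_inj.
  + by [].
Qed.

Lemma brin_navas_graded : brin_navas R `<=` \bigcup_i graded i.
Proof.
apply: (@generated_sub _ _ (Subgroup graded_is_subgroup)) => _ [->|->].
  exists 1%R => //; exists 0, 1%N, 0, 1; split=> //.
  by rewrite expg0 expg1 ext1 invg1 !mulg1.
exists 0%R => //; exists 0, 0, 1%N, rot; split=> //; first exact: tower_rot.
by rewrite expg0 invg1 mul1g mulg1.
Qed.

Lemma ea_brin_navas : elementary_amenable (brin_navas R).
Proof. exact: (@ea_sub _ (Subgroup graded_is_subgroup) _ brin_navas_graded
  ea_graded). Qed.

Lemma f_conj_iter n phi :
  ext mid phi = f ^+ n * ext mid (iter n (ext mid) phi) * (f ^+ n)^-1.
Proof.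
elim: n => [|n IHn]; first by rewrite expg0 invg1 mul1g mulg1.
rewrite {1}IHn [in LHS]f_conj /=; move: (expander R) => e.
by rewrite expgSr invgM !mulgA.
Qed.

Lemma tower_iter_inv n k phi : tower k 0 (iter n (ext mid) phi) ->
  exists j, tower j 0 phi.
Proof.
elim: n k => [|n IHn] k /=; first by exists k.
by move=> /tower_ext_inv[j /IHn].
Qed.

(** The action near 0 forces the two exponents of [f] to be equal. Conjugating by
    that power of [f] then places the rotation deeper in the tiling, from where
    [tower_ext_inv] brings it back to the impossible case [not_tower]. *)
Lemma not_graded : ~ (\bigcup_i graded i) (ext (mid ++ [:: false]) rot).
Proof.
move=> [_ _ [m [n [k [phi [_ phik e]]]]]].
have mn : m = n.
  have h0 : maps (f ^+ n * ext mid phi * (f ^+ m)^-1)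
      (nseq (m + 0).+2 false) (nseq (n + 0).+2 false).
    apply: mapsM (mapsV (@maps_fX_zeros R m 0)) _.
    by apply: mapsM (@maps_fX_zeros R n 0); exact: maps_ext_mid_00.
  rewrite -e ext_cat !addn0 in h0.
  have /(congr1 size) := maps_uniq (maps_ext_mid_00 _ (nseq m false)) h0.
  by rewrite /= !size_nseq => -[].
move: e; rewrite mn ext_cat (f_conj_iter n) => /mulIg/mulgI/ext_inj e.
rewrite -e in phik; have [j] := tower_iter_inv phik.
exact: not_tower.
Qed.

End Tower.

(** * The degree *)

Section Degree.
Variable R : realType.
Local Notation F := (thompsonF R).
Implicit Types (h k : F) (i j : int).
Local Open Scope group_scope.

Local Notation rot := (rotation R).
Local Notation K := (balanced R).

(** The slopes of [h] at 0 and 1 are [2 ^ (m - n)] and [2 ^ (m - n')]; the degree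
    is the difference of their exponents. *)
Definition has_degree h i := exists m n n',
  [/\ maps h (nseq m false) (nseq n false), maps h (nseq m true) (nseq n' true)
    & i = (Posz n - Posz n')%R].

Lemma has_degree_exists h : exists i, has_degree h i.
Proof.
have [m [n h0]] := maps_ends h false; have [m' [n' h1]] := maps_ends h true.
(* Both ends are refined to the common depth [m + m']. *)
exists (Posz (n + m') - Posz (n' + m))%R, (m + m')%N, (n + m')%N, (n' + m)%N.
by split=> //; [exact: maps_nseq|rewrite addnC; exact: maps_nseq].
Qed.

Lemma has_degree_unique h i j : has_degree h i -> has_degree h j -> i = j.
Proof.
move=> [m [n [n' [h0 h1 ->]]]] [p [q [q' [k0 k1 ->]]]].
have := maps_nseq m k0; have := maps_nseq p h0; rewrite addnC => e0.
have := maps_nseq m k1; have := maps_nseq p h1; rewrite addnC => e1.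
move=> /(maps_uniq e1)/(congr1 size) + /(maps_uniq e0)/(congr1 size).
by rewrite !size_nseq; lia.
Qed.

Definition degree h : int := sval (cid (has_degree_exists h)).

Lemma degreeP h : has_degree h (degree h).
Proof. by rewrite /degree; case: cid. Qed.

Lemma degreeM h k : degree (h * k) = (degree h + degree k)%R.
Proof.
apply: has_degree_unique (degreeP _) _.
have [m [n [n' [h0 h1 ->]]]] := degreeP h.
have [p [q [q' [k0 k1 ->]]]] := degreeP k.
exists (p + m)%N, (n + q)%N, (n' + q')%N; split; last by lia.
  by apply: mapsM (maps_nseq m k0) _; rewrite addnC; exact: maps_nseq.
by apply: mapsM (maps_nseq m k1) _; rewrite addnC; exact: maps_nseq.
Qed.

Lemma degree1 : degree 1 = 0%R.
Proof. by have := degreeM 1 1; rewrite mulg1; lia. Qed.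

Lemma degreeV h : degree h^-1 = (- degree h)%R.
Proof. by have := degreeM h h^-1; rewrite mulgV degree1; lia. Qed.

Lemma degreeX h n : degree (h ^+ n) = (degree h *+ n)%R.
Proof.
by elim: n => [|n IHn]; rewrite ?expg0 ?degree1 // expgS degreeM IHn mulrS.
Qed.

Lemma degree_balanced h : (K : set F) h <-> degree h = 0%R.
Proof.
split=> [[m [n [h0 h1]]]|deg0].
  apply: has_degree_unique (degreeP _) _.
  by exists m, n, n; split=> //; rewrite subrr.
have [m [n [n' [h0 h1]]]] := degreeP h; rewrite deg0 => nn'.
by exists m, n; split=> //; have -> : n = n' by lia.
Qed.

Lemma balanced_normal : normal K.
Proof.
move=> h x /degree_balanced x0; apply/degree_balanced.
by rewrite /conjg !degreeM degreeV x0; lia.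
Qed.

Definition unit_shift : F := (ext [:: true] rot)^-1.
Local Notation t := unit_shift.

Lemma degree_unit_shift : degree t = 1%R.
Proof.
rewrite degreeV; suff -> : degree (ext [:: true] rot) = (-1)%R by lia.
apply: has_degree_unique (degreeP _) _; exists 2, 2, 3; split=> //.
  apply: (@maps_cat _ _ [:: false] [:: false]); exact: maps_ext_other.
by apply: (@maps_ext _ [:: true] _ [:: true] [:: true; true]);
  exact: maps_rot_1.
Qed.

Lemma balanced_coset h : exists n,
  (K : set F) (h^-1 * t ^+ n) \/ (K : set F) (h^-1 * (t ^+ n)^-1).
Proof.
case hd : (degree h) => [n|n].
  exists n; left; apply/degree_balanced.
  by rewrite degreeM degreeV degreeX degree_unit_shift hd natz; lia.
exists n.+1; right; apply/degree_balanced.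
by rewrite degreeM !degreeV degreeX degree_unit_shift hd natz; lia.
Qed.

Lemma quotient_balanced_cyclic : infinite_cyclic (quotient balanced_normal).
Proof.
pose Q := quotient balanced_normal; pose pi (x : F) : Q := \pi_Q x.
have piM x y : pi (x * y) = pi x * pi y by exact: quotient_mulE.
have piV x : pi x^-1 = (pi x)^-1 by exact: quotient_invE.
have piX x n : pi (x ^+ n) = pi x ^+ n.
  by elim: n => // n IHn; rewrite !expgS piM IHn.
split.
  exists (pi t); apply/seteqP; split=> // u _; rewrite -[u]reprK.
  pose D := generated_subgroup [set pi t].
  have Dt : (D : set Q) (pi t) by apply: sub_generated.
  rewrite -[generated _]/(D : set Q) -/(pi (repr u)).
  have [n [kn|kn]] := balanced_coset (repr u).
    have -> : pi (repr u) = pi (t ^+ n) by apply/quotient_eqP.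
    by rewrite piX; exact: subgroupX.
  have -> : pi (repr u) = pi (t ^+ n)^-1 by apply/quotient_eqP.
  by rewrite piV piX; apply: subgroupV; exact: subgroupX.
move=> finQ; apply: infinite_nat.
have -> : [set: nat] = (fun n => pi (t ^+ n)) @^-1` [set: Q] by [].
apply: finite_preimage finQ => m n _ _ /quotient_eqP/degree_balanced.
by rewrite degreeM degreeV !degreeX degree_unit_shift !natz; lia.
Qed.

Lemma brin_navas_fg : finitely_generated (brin_navas R).
Proof.
exact: (@finitely_generated_subgroup _ _
  [set expander R; ext [:: false; true] rot]).
Qed.

Definition balanced_gens : set F := [set expander R; ext [:: false; true] rot;
  ext [:: false; true; false] rot].

(** By maximality of the subgroup generated by the first two elements, the third
    one lying outside it. *)
Lemma balanced_generated : generated balanced_gens = K.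
Proof.
pose M := generated_subgroup balanced_gens.
have gens : balanced_gens `<=` M by exact: sub_generated.
apply/seteqP; split.
  apply: generated_sub => _ [[->|->]|->].
  - exact: brin_navas_sub_balanced (@brin_navas_f R).
  - exact: balanced_ext_mid.
  - by rewrite (ext_cat [:: false; true] [:: false]); exact: balanced_ext_mid.
apply: (@brin_navas_maximal _ M).
- by apply: generated_sub => x [->|->]; apply: gens; left; [left|right].
- apply: generated_sub => _ [[->|->]|->].
  + exact: brin_navas_sub_balanced (@brin_navas_f R).
  + exact: balanced_ext_mid.
  + by rewrite (ext_cat [:: false; true] [:: false]); exact: balanced_ext_mid.
- exists (ext [:: false; true; false] rot); first by apply: gens; right.
  by move=> /brin_navas_graded; exact: not_graded.
Qed.

Lemma balanced_gens_finite : finite_set balanced_gens.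
Proof. by rewrite !finite_setU; split=> //; split. Qed.

Lemma thompson_generated : generated (balanced_gens `|` [set t]) = setT.
Proof.
apply/seteqP; split=> // h _.
pose M := generated_subgroup (balanced_gens `|` [set t]).
have Mt : (M : set F) t by apply: sub_generated; right.
have KM : K `<=` M.
  by rewrite -balanced_generated; apply: generated_sub => x gx;
    apply: sub_generated; left.
suff : (M : set F) h^-1 by move/subgroupV; rewrite invgK.
have [n [/KM|/KM]] := balanced_coset h.
  by move/(subgroupMr _ (subgroupX n Mt)).
by move/(subgroupMr _ (subgroupV (subgroupX n Mt))).
Qed.

End Degree.

Theorem theorem1p5 (R : realType) :
  exists B K : subgroup (thompsonF R),
    [/\ B `<` K /\ K `<` setT,
        [/\ finitely_generated B, finitely_generated K
          & finitely_generated (thompsonF R)],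
        elementary_amenable B,
        maximal_in B K
      & exists nK : normal K, infinite_cyclic (quotient nK)].
Proof.
have BK : brin_navas R `<` balanced R.
  split; first exact: brin_navas_sub_balanced.
  move=> /(_ _ (balanced_ext_mid (ext [:: false] (rotation R)))).
  by rewrite -ext_cat => /brin_navas_graded; exact: not_graded.
exists (brin_navas R), (balanced R); split.
- split=> //; split=> // /(_ (unit_shift R) Logic.I)/degree_balanced.
  by rewrite degree_unit_shift.
- split; first exact: brin_navas_fg.
    exact: finitely_generated_subgroup (@balanced_gens_finite R)
      (balanced_generated R).
  exists (@balanced_gens R `|` [set unit_shift R]);
    last exact: thompson_generated.
  by rewrite finite_setU; split=> //; exact: balanced_gens_finite.
- exact: ea_brin_navas.
- split=> // M BM MK; have [MB|] := pselect (M `<=` brin_navas R).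
    by left; apply/seteqP.
  move=> MB; right; apply/seteqP; split=> //.
  apply: brin_navas_maximal BM MK _.
  by apply: contrapT => no_h; apply: MB => h Mh; apply: contrapT => Bh;
    apply: no_h; exists h.
- by exists (@balanced_normal R); exact: quotient_balanced_cyclic.
Qed.
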